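(* Let $R$ be a complete local-filtered ring with filtration $(F^i(R))_{i\ge 0}$. Then the following statements hold. (1) $R$ is a local ring with maximal ideal $F^1(R)$. (2) $R$ is strongly left Noetherian. (3) For all integers $i,j\in\mathbb{N}_0$, we have $F^i(R)F^j(R)=F^{i+j}(R)$. (4) The Rees ring $\mathbf{R}(R)$ is strongly left Noetherian.
   Context: Rings are unital and not necessarily associative; ''commutative ring/algebra'' means commutative and associative. $\mathbb{N}_0=\{0,1,2,\dots\}$. For subsets $A,B$ of a ring $R$, $AB$ denotes the additive subgroup of all finite sums $\sum ab$ with $a\in A$, $b\in B$. A filtered ring is a ring $R$ with a decreasing sequence of (two-sided) ideals $F^0(R)\supseteq F^1(R)\supseteq\cdots$ such that $F^0(R)=R$ and $F^i(R)F^j(R)\subseteq F^{i+j}(R)$ for all $i,j\ge 0$. The associated graded ring is $\mathrm{gr}(R)=\bigoplus_{i\ge0}F^i(R)/F^{i+1}(R)$ with the induced multiplication. The filtration is complete if the natural map $R\to\varprojlim R/F^i(R)$ is an isomorphism. A complete local-filtered ring is a filtered ring $R$ whose filtration is complete and such that (C1) $R/F^1(R)$ is a field, and (C2) $\mathrm{gr}(R)$ is a finitely generated commutative $R/F^1(R)$-algebra, generated in degree $1$. A ring $S$ is strongly left Noetherian if every left ideal $I$ of $S$ is finitely spanned, i.e. there are finitely many $x_1,\dots,x_n\in I$ with $I=Sx_1+\dots+Sx_n$. The Rees ring of a filtered ring $R$ is the subring $\mathbf{R}(R)=R\oplus F^1(R)X\oplus F^2(R)X^2\oplus\cdots$ of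 the polynomial ring $R[X]$, where $X$ is a central indeterminate. ''$R$ is a local ring with maximal ideal $F^1(R)$'' means that $F^1(R)$ is a proper two-sided ideal of $R$ that contains every proper left ideal of $R$. *)

(* Defs.v *)
From HB Require Import structures.
From mathcomp Require Import all_boot all_algebra.
From mathcomp Require Import ring_quotient.
From mathcomp Require Import mathcomp_extra boolp classical_sets.

Set Implicit Arguments.
Unset Strict Implicit.
Unset Printing Implicit Defensive.

Import GRing.Theory.

Local Open Scope quotient_scope.
Local Open Scope classical_set_scope.
Local Open Scope ring_scope.

HB.mixin Record Zmodule_UMagma_isNARing R of GRing.Zmodule R & UMagma R := {
  namulDl : left_distributive ( *%g : R -> R -> R) +%R;
  namulDr : right_distributive ( *%g : R -> R -> R) +%R
}.

(* Unital, not necessarily associative rings: the multiplication and the unit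
   are those of the MathComp magma structure. *)
#[short(type="naRingType")]
HB.structure Definition NARing :=
  {R of GRing.Zmodule R & UMagma R & Zmodule_UMagma_isNARing R}.

(* The arguments of [+] are parsed in [ring_scope], where [x * y] requires an
   associative ring. *)
Notation "x ** y" := ( *%g x%R y%R)
  (at level 40, left associativity) : ring_scope.

Section NARingTheory.
Variable R : naRingType.
Implicit Types x y : R.

Lemma namulBl x y z : (x - y) ** z = x ** z - y ** z.
Proof. by apply/eqP; rewrite eq_sym subr_eq -namulDl subrK. Qed.

Lemma namulBr x y z : z ** (x - y) = z ** x - z ** y.
Proof. by apply/eqP; rewrite eq_sym subr_eq -namulDr subrK. Qed.

Lemma namul0r x : 0 ** x = 0.
Proof. by rewrite -(subrr x) namulBl !subrr. Qed.

Lemma namulr0 x : x ** 0 = 0.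
Proof. by rewrite -(subrr x) namulBr !subrr. Qed.

(* This is an additive subgroup as soon as A or B is stable under opposite. *)
Definition prodset (A B : set R) : set R :=
  [set x | exists n (a b : 'I_n -> R),
    [/\ forall i, A (a i), forall i, B (b i) & x = \sum_i a i ** b i]].

Definition left_ideal (I : set R) : Prop :=
  [/\ I 0, forall x y, I x -> I y -> I (x - y) & forall a x, I x -> I (a ** x)].

Definition finitely_spanned (I : set R) : Prop :=
  exists n (x : 'I_n -> R),
    (forall i, I (x i)) /\
    I = [set y | exists s : 'I_n -> R, y = \sum_i s i ** x i].

Definition na_is_field : Prop :=
  [/\ (1%g : R) <> 0, associative ( *%g : R -> R -> R),
      commutative ( *%g : R -> R -> R)
    & forall x : R, x <> 0 -> exists y, x ** y = 1%g].

End NARingTheory.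

Definition strongly_left_noetherian (S : naRingType) : Prop :=
  forall I : set S, left_ideal I -> finitely_spanned I.

HB.mixin Record isTwoSidedClosed (R : naRingType) (S : {pred R}) := {
  idealMl : forall a x : R, x \in S -> a ** x \in S;
  idealMr : forall a x : R, x \in S -> x ** a \in S
}.

(* The unit ideal is allowed.  Boolean predicates are arbitrary subsets, by the
   classical axioms of boolp. *)
#[short(type="twoSidedIdeal")]
HB.structure Definition TwoSidedIdeal (R : naRingType) :=
  {S of GRing.ZmodClosed R S & isTwoSidedClosed R S}.

Definition local_with_maximal_ideal (R : naRingType) (M : twoSidedIdeal R) :
    Prop :=
  [set` M] <> setT /\
  forall I : set R, left_ideal I -> I <> setT -> I `<=` [set` M].

Section QuotientRing.
Variables (R : naRingType) (I : twoSidedIdeal R).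
Local Notation Q := {ideal_quot I}.

Definition quot_mul (x y : Q) : Q := \pi_Q (repr x ** repr y).

Lemma quot_piP (x y : R) : reflect (\pi_Q x = \pi_Q y) (x - y \in I).
Proof. by rewrite Quotient.idealrBE; exact: eqP. Qed.

Lemma quot_mulE (x y : R) : quot_mul (\pi_Q x) (\pi_Q y) = \pi_Q (x ** y).
Proof.
apply/quot_piP; set x' := repr _; set y' := repr _.
have hx : x' - x \in I by apply/quot_piP; rewrite reprK.
have hy : y' - y \in I by apply/quot_piP; rewrite reprK.
rewrite -[x' ** y'](subrK (x' ** y)) -namulBr -addrA -namulBl.
by apply: rpredD; [exact: idealMl | exact: idealMr].
Qed.

Lemma quot_mul1 : left_id (\pi_Q 1%g) quot_mul.
Proof. by move=> x; rewrite -[x]reprK quot_mulE mul1g. Qed.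

Lemma quot_mulr1 : right_id (\pi_Q 1%g) quot_mul.
Proof. by move=> x; rewrite -[x]reprK quot_mulE mulg1. Qed.

Lemma quot_mulDl : left_distributive quot_mul +%R.
Proof.
move=> x y z; rewrite -[x]reprK -[y]reprK -[z]reprK.
by rewrite -raddfD !quot_mulE -raddfD namulDl.
Qed.

Lemma quot_mulDr : right_distributive quot_mul +%R.
Proof.
move=> x y z; rewrite -[x]reprK -[y]reprK -[z]reprK.
by rewrite -raddfD !quot_mulE -raddfD namulDr.
Qed.

HB.instance Definition _ := hasMul.Build Q quot_mul.
HB.instance Definition _ := Magma_isUMagma.Build Q quot_mul1 quot_mulr1.
HB.instance Definition _ :=
  Zmodule_UMagma_isNARing.Build Q quot_mulDl quot_mulDr.
End QuotientRing.

(* A decreasing exhaustive multiplicative filtration, making R a filtered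
   ring. *)
Record filtration (R : naRingType) := Filtration {
  filt :> nat -> twoSidedIdeal R;
  filt0 : [set` filt 0%N] = setT;
  filtS : forall i, [set` filt i.+1] `<=` [set` filt i];
  filtM : forall i j, prodset [set` filt i] [set` filt j] `<=` [set` filt (i + j)%N]
}.

Section FiltrationTheory.
Variables (R : naRingType) (F : filtration R).

Lemma mem_filt0 x : x \in F 0%N.
Proof. by have : [set` F 0%N] x by rewrite filt0. Qed.

Lemma mem_filtS i x : x \in F i.+1 -> x \in F i.
Proof. exact: filtS. Qed.

Lemma mem_filtM i j n x y : (i + j)%N = n ->
  x \in F i -> y \in F j -> x ** y \in F n.
Proof.
move=> <- hx hy; apply: (@filtM _ F i j).
exists 1%N, (fun=> x), (fun=> y); split=> //.
by rewrite big_ord_recl big_ord0 addr0.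
Qed.

Definition quot_proj i j (x : {ideal_quot F j}) : {ideal_quot F i} :=
  \pi_{ideal_quot F i} (repr x).

(* The set underlying the inverse limit of the R / F^i(R). *)
Definition inverse_limit : Type :=
  {x : forall i, {ideal_quot F i} |
    forall i j, (i <= j)%N -> quot_proj i (x j) = x i}.

Lemma filt_le i j x : (i <= j)%N -> x \in F j -> x \in F i.
Proof.
move/subnK <-; elim: (j - i)%N => // k ih hx.
by apply: ih; apply: mem_filtS.
Qed.

Lemma to_inverse_limit_subproof (x : R) i j : (i <= j)%N ->
  quot_proj i (\pi_{ideal_quot F j} x) = \pi_{ideal_quot F i} x.
Proof.
move=> ij; apply/quot_piP; apply: filt_le ij _.
by apply/quot_piP; rewrite reprK.
Qed.

Definition to_inverse_limit (x : R) : inverse_limit :=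
  exist _ (fun i => \pi_{ideal_quot F i} x) (to_inverse_limit_subproof x).

(* The natural map is a ring morphism for the componentwise operations. *)
Definition complete : Prop := bijective to_inverse_limit.

End FiltrationTheory.

(* N-graded rings, given by their homogeneous components.  The index n is
   separate from i + j so that no cast is needed in the convolution. *)
Record gradedRing := GradedRing {
  gcomp :> nat -> zmodType;
  gone : gcomp 0%N;
  gmul : forall i j n, (i + j)%N = n -> gcomp i -> gcomp j -> gcomp n;
  gmulDl : forall i j n (e : (i + j)%N = n) (a b : gcomp i) (c : gcomp j),
    gmul e (a + b) c = gmul e a c + gmul e b c;
  gmulDr : forall i j n (e : (i + j)%N = n) (a : gcomp i) (b c : gcomp j),
    gmul e a (b + c) = gmul e a b + gmul e a c;
  gmul1l : forall n (e : (0 + n)%N = n) (a : gcomp n), gmul e gone a = a;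
  gmul1r : forall n (e : (n + 0)%N = n) (a : gcomp n), gmul e a gone = a
}.

(* The total ring of G: the direct sum of its components. *)
Record dsum (G : gradedRing) := DSum {
  coord :> forall n, G n;
  coord_finite : exists N, forall n, (N <= n)%N -> coord n = 0
}.

Section DirectSum.
Variable G : gradedRing.
Implicit Types x y z : dsum G.

HB.instance Definition _ := gen_eqMixin (dsum G).
HB.instance Definition _ := gen_choiceMixin (dsum G).

Lemma dsumP x y : (forall n, x n = y n) -> x = y.
Proof.
case: x y => [x hx] [y hy] /= exy.
have {exy} exy : x = y by exact: functional_extensionality_dep.
by case: _ / exy in hy *; congr DSum; exact: Prop_irrelevance.
Qed.

Lemma dsum_add_subproof x y :
  exists N, forall n, (N <= n)%N -> x n + y n = 0.
Proof.
case: (coord_finite x) (coord_finite y) => [N hN] [M hM].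
exists (maxn N M) => n; rewrite geq_max => /andP[/hN -> /hM ->].
exact: addr0.
Qed.

Lemma dsum_opp_subproof x : exists N, forall n, (N <= n)%N -> - x n = 0.
Proof.
by case: (coord_finite x) => [N hN]; exists N => n /hN ->; rewrite oppr0.
Qed.

Definition dsum_zero : dsum G :=
  @DSum G (fun=> 0) (ex_intro _ 0%N (fun _ _ => erefl)).
Definition dsum_add x y : dsum G := DSum (dsum_add_subproof x y).
Definition dsum_opp x : dsum G := DSum (dsum_opp_subproof x).

Lemma dsum_addA : associative dsum_add.
Proof. by move=> x y z; apply: dsumP => n; apply: addrA. Qed.
Lemma dsum_addC : commutative dsum_add.
Proof. by move=> x y; apply: dsumP => n; apply: addrC. Qed.
Lemma dsum_add0 : left_id dsum_zero dsum_add.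
Proof. by move=> x; apply: dsumP => n; apply: add0r. Qed.
Lemma dsum_addN : left_inverse dsum_zero dsum_opp dsum_add.
Proof. by move=> x; apply: dsumP => n; apply: addNr. Qed.

HB.instance Definition _ :=
  GRing.isZmodule.Build (dsum G) dsum_addA dsum_addC dsum_add0 dsum_addN.

Lemma gmul0l i j n (e : (i + j)%N = n) (c : G j) : gmul e (0 : G i) c = 0.
Proof. by apply: (addrI (gmul e 0 c)); rewrite -gmulDl !addr0. Qed.

Lemma gmul0r i j n (e : (i + j)%N = n) (c : G i) : gmul e c (0 : G j) = 0.
Proof. by apply: (addrI (gmul e c 0)); rewrite -gmulDr !addr0. Qed.

Definition dsum_mul_coord x y n : G n :=
  \sum_(i < n.+1) gmul (subnKC (leq_ord i)) (x i) (y (n - i)%N).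

Lemma dsum_mul_subproof x y :
  exists N, forall n, (N <= n)%N -> dsum_mul_coord x y n = 0.
Proof.
case: (coord_finite x) (coord_finite y) => [N hN] [M hM].
exists (N + M)%N => n hn; apply: big1 => i _.
have [/hN -> | iN] := leqP N i; first exact: gmul0l.
rewrite hM ?gmul0r // leq_subRL ?leq_ord // addnC.
by apply: leq_trans hn; rewrite addnC leq_add2r ltnW.
Qed.

Definition dsum_mul x y : dsum G := DSum (dsum_mul_subproof x y).

Definition const_coord (a : G 0%N) n : G n := if n is 0 then a else 0.

Lemma const_subproof (a : G 0%N) :
  exists N, forall n, (N <= n)%N -> const_coord a n = 0.
Proof. by exists 1%N; case. Qed.

(* The inclusion of the component of degree 0. *)
Definition dsum_const (a : G 0%N) : dsum G := DSum (const_subproof a).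

Lemma dsum_mul1 : left_id (dsum_const (gone G)) dsum_mul.
Proof.
move=> x; apply: dsumP => n /=.
rewrite /dsum_mul_coord big_ord_recl big1 => [|i _]; last exact: gmul0l.
rewrite addr0 /=; move: (subnKC _) => /=; move: (n - 0)%N => m e.
have e' : m = n by [].
by case: _ / e' in e *; apply: gmul1l.
Qed.

Lemma dsum_mulr1 : right_id (dsum_const (gone G)) dsum_mul.
Proof.
move=> x; apply: dsumP => n /=.
rewrite /dsum_mul_coord big_ord_recr big1 => [|i _] /=; last first.
  have : (0 < n - i)%N by rewrite subn_gt0 ltn_ord.
  move: (subnKC _) => /=; move: (n - i)%N => [|m] // e _.
  exact: gmul0r.
rewrite add0r; move: (subnKC _) => /=; rewrite subnn => e.
exact: gmul1r.
Qed.

Lemma dsum_mulDl : left_distributive dsum_mul +%R.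
Proof.
move=> x y z; apply: dsumP => n /=.
by rewrite /dsum_mul_coord -big_split; apply: eq_bigr => i _; apply: gmulDl.
Qed.

Lemma dsum_mulDr : right_distributive dsum_mul +%R.
Proof.
move=> x y z; apply: dsumP => n /=.
by rewrite /dsum_mul_coord -big_split; apply: eq_bigr => i _; apply: gmulDr.
Qed.

HB.instance Definition _ := hasMul.Build (dsum G) dsum_mul.
HB.instance Definition _ := Magma_isUMagma.Build (dsum G) dsum_mul1 dsum_mulr1.
HB.instance Definition _ :=
  Zmodule_UMagma_isNARing.Build (dsum G) dsum_mulDl dsum_mulDr.

Definition homogeneous k : set (dsum G) :=
  [set x | forall n, n <> k -> x n = 0].

End DirectSum.

Section AssociatedGraded.
Variables (R : naRingType) (F : filtration R).

Definition filt_sub n : Type := {x : R | x \in F n}.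
HB.instance Definition _ n := SubChoice.on (filt_sub n).
HB.instance Definition _ n :=
  [SubChoice_isSubZmodule of filt_sub n by <:].

Lemma filt_sub_valD n (x y : filt_sub n) : val (x + y) = val x + val y.
Proof. exact: raddfD. Qed.

Definition filt_next n : {pred filt_sub n} := fun x => val x \in F n.+1.
Arguments filt_next : clear implicits.

Lemma filt_next_closed n : zmod_closed (filt_next n).
Proof.
split=> [|x y hx hy]; rewrite unfold_in /= ?raddf0 ?raddfB ?rpred0 //.
by rewrite rpredB.
Qed.
HB.instance Definition _ n :=
  GRing.isZmodClosed.Build (filt_sub n) (filt_next n) (filt_next_closed n).

(* F^n(R) / F^(n+1)(R) *)
Definition gr_comp n : zmodType := {ideal_quot (filt_next n)}.

Definition gr_class n (x : filt_sub n) : gr_comp n :=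
  \pi_{ideal_quot (filt_next n)} x.
Definition gr_repr n (a : gr_comp n) : filt_sub n := repr a.

Definition filt_sub_mul i j n (e : (i + j)%N = n)
    (x : filt_sub i) (y : filt_sub j) : filt_sub n :=
  exist _ (val x ** val y) (mem_filtM e (valP x) (valP y)).

Definition gr_mul i j n (e : (i + j)%N = n) (a : gr_comp i) (b : gr_comp j) :
    gr_comp n :=
  gr_class (filt_sub_mul e (gr_repr a) (gr_repr b)).

Lemma gr_classP n (x y : filt_sub n) :
  reflect (gr_class x = gr_class y) (val x - val y \in F n.+1).
Proof.
have -> : (val x - val y \in F n.+1) = (x - y \in filt_next n).
  by rewrite [RHS]unfold_in raddfB.
by rewrite Quotient.idealrBE; exact: eqP.
Qed.

Lemma gr_reprK n (a : gr_comp n) : gr_class (gr_repr a) = a.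
Proof. exact: reprK. Qed.

Lemma gr_classD n (x y : filt_sub n) :
  gr_class (x + y) = gr_class x + gr_class y.
Proof. exact: raddfD. Qed.

Lemma gr_mulE i j n (e : (i + j)%N = n) (x : filt_sub i) (y : filt_sub j) :
  gr_mul e (gr_class x) (gr_class y) = gr_class (filt_sub_mul e x y).
Proof.
apply/gr_classP => /=; set x' := gr_repr _; set y' := gr_repr _.
have hx : val x' - val x \in F i.+1 by apply/gr_classP; rewrite gr_reprK.
have hy : val y' - val y \in F j.+1 by apply/gr_classP; rewrite gr_reprK.
rewrite -[val x' ** val y'](subrK (val x' ** val y)) -namulBr -addrA -namulBl.
apply: rpredD.
  by apply: (mem_filtM _ (valP x') hy); rewrite addnS e.
by apply: (mem_filtM _ hx (valP y)); rewrite addSn e.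
Qed.

Lemma gr_mulDl i j n (e : (i + j)%N = n) (a b : gr_comp i) (c : gr_comp j) :
  gr_mul e (a + b) c = gr_mul e a c + gr_mul e b c.
Proof.
rewrite -[a]gr_reprK -[b]gr_reprK -[c]gr_reprK -gr_classD !gr_mulE -gr_classD.
congr gr_class; apply: val_inj; rewrite filt_sub_valD.
by rewrite -[LHS]/(val (gr_repr a + gr_repr b) ** _) filt_sub_valD namulDl.
Qed.

Lemma gr_mulDr i j n (e : (i + j)%N = n) (a : gr_comp i) (b c : gr_comp j) :
  gr_mul e a (b + c) = gr_mul e a b + gr_mul e a c.
Proof.
rewrite -[a]gr_reprK -[b]gr_reprK -[c]gr_reprK -gr_classD !gr_mulE -gr_classD.
congr gr_class; apply: val_inj; rewrite filt_sub_valD.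
by rewrite -[LHS]/(_ ** val (gr_repr b + gr_repr c)) filt_sub_valD namulDr.
Qed.

Definition filt_sub0 (x : R) : filt_sub 0 := exist _ x (mem_filt0 F x).

Definition gr_one : gr_comp 0 := gr_class (filt_sub0 1%g).

Lemma gr_mul1l n (e : (0 + n)%N = n) (a : gr_comp n) : gr_mul e gr_one a = a.
Proof.
rewrite -[a]gr_reprK gr_mulE; congr gr_class; apply: val_inj; exact: mul1g.
Qed.

Lemma gr_mul1r n (e : (n + 0)%N = n) (a : gr_comp n) : gr_mul e a gr_one = a.
Proof.
rewrite -[a]gr_reprK gr_mulE; congr gr_class; apply: val_inj; exact: mulg1.
Qed.

Definition gr_graded : gradedRing :=
  GradedRing gr_mulDl gr_mulDr gr_mul1l gr_mul1r.

Definition gr : naRingType := dsum gr_graded.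

(* The structure map of the (R / F^1(R))-algebra gr(R). *)
Definition gr_scalar (c : {ideal_quot F 1%N}) : gr :=
  dsum_const (gr_class (filt_sub0 (repr c)) : gr_graded 0%N).

End AssociatedGraded.

Section GeneratedSubalgebra.
Variables (K A : naRingType) (iota : K -> A).

Definition subalgebra (B : set A) : Prop :=
  [/\ B 1%g, forall x y, B x -> B y -> B (x - y),
      forall x y, B x -> B y -> B (x ** y)
    & forall (c : K) x, B x -> B (iota c ** x)].

Definition generates (X : set A) : Prop :=
  forall B, subalgebra B -> X `<=` B -> B = setT.

Definition finitely_generated : Prop :=
  exists n (x : 'I_n -> A), generates (range x).

End GeneratedSubalgebra.

Definition complete_local_filtered (R : naRingType) (F : filtration R) : Prop :=
  [/\ complete F,
      na_is_field {ideal_quot F 1%N},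
      associative ( *%g : gr F -> gr F -> gr F) /\
      commutative ( *%g : gr F -> gr F -> gr F),
      finitely_generated (@gr_scalar R F)
    & generates (@gr_scalar R F) (@homogeneous (gr_graded F) 1)].

Section ReesRing.
Variable R : naRingType.

Definition poly_coef_mul i j n (_ : (i + j)%N = n) (a b : R) : R := a ** b.

Definition poly_graded : gradedRing :=
  @GradedRing (fun=> R) 1%g poly_coef_mul
    (fun _ _ _ _ => @namulDl R) (fun _ _ _ _ => @namulDr R)
    (fun _ _ => @mul1g R) (fun _ _ => @mulg1 R).

(* The polynomial ring R[X] with X central; [p n] is the coefficient of X^n. *)
Definition na_poly : naRingType := dsum poly_graded.

Variable F : filtration R.

Definition rees_pred : {pred na_poly} :=
  fun p => `[< forall n, (p n : R) \in F n >].

Lemma rees_zmod_closed : zmod_closed rees_pred.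
Proof.
split=> [|p q /asboolP hp /asboolP hq]; apply/asboolP => n /=.
  exact: rpred0.
exact: rpredB.
Qed.
HB.instance Definition _ :=
  GRing.isZmodClosed.Build na_poly rees_pred rees_zmod_closed.

Lemma rees_umagma_closed : umagma_closed rees_pred.
Proof.
split=> [|p q /asboolP hp /asboolP hq]; apply/asboolP => n /=.
  by case: n => [|n]; [exact: mem_filt0 | exact: rpred0].
apply: rpred_sum => i _.
by apply: mem_filtM (hp _) (hq _); rewrite subnKC ?leq_ord.
Qed.

Definition rees : Type := {p : na_poly | p \in rees_pred}.
HB.instance Definition _ := SubChoice.on rees.
HB.instance Definition _ := [SubChoice_isSubZmodule of rees by <:].
HB.instance Definition _ :=
  SubChoice_isSubUMagma.Build na_poly rees_pred rees rees_umagma_closed.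

Lemma rees_mulDl : left_distributive ( *%g : rees -> rees -> rees) +%R.
Proof.
by move=> p q r; apply: val_inj; rewrite raddfD !valM raddfD namulDl.
Qed.
Lemma rees_mulDr : right_distributive ( *%g : rees -> rees -> rees) +%R.
Proof.
by move=> p q r; apply: val_inj; rewrite raddfD !valM raddfD namulDr.
Qed.
HB.instance Definition _ :=
  Zmodule_UMagma_isNARing.Build rees rees_mulDl rees_mulDr.

End ReesRing.

(* Main.v *)
(* Write gr(R)[X] for the polynomials over the associated graded ring, and S for
   its subalgebra of the polynomials whose coefficient of X^n lives in degrees at
   least n.  By generation in degree 1, S is generated over the field R / F^1 by
   the elements y and y X with y in a finite generating set of gr_1, so S is
   Noetherian by Hilbert's basis theorem.  A graded left ideal J of the Rees ring
   has a bigraded ideal of principal symbols in S; lifts of bihomogeneous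
   generators of it generate J by successive approximation, since R is complete.
   No associativity of R is used, because every approximating combination is
   linear in the fixed generators.  A general left ideal of the Rees ring is
   handled through leading coefficients, and R itself through constant terms.
   The same approximation gives R = R z for every z = 1 modulo F^1, and
   F^(i+j) = F^i F^j from gr_(i+j) = gr_i gr_j. *)
Require Import Defs.
From HB Require Import structures.
From mathcomp Require Import all_boot all_algebra.
From mathcomp Require Import ring_quotient.
From mathcomp Require Import boolp classical_sets.

Set Implicit Arguments.
Unset Strict Implicit.
Unset Printing Implicit Defensive.

Import GRing.Theory.

Local Open Scope quotient_scope.
Local Open Scope classical_set_scope.
Local Open Scope ring_scope.

(** * Additive spans *)

Inductive span (V : nmodType) (G : set V) : set V :=
| span0 : span G 0
| spanDl g x of G g & span G x : span G (g + x).

Section Span.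
Variables (V : nmodType) (G : set V).

Lemma span_gen g : G g -> span G g.
Proof. by move=> Gg; rewrite -[g]addr0; apply: spanDl => //; exact: span0. Qed.

Lemma spanD x y : span G x -> span G y -> span G (x + y).
Proof.
elim=> [|g z Gg _ ih] hy; first by rewrite add0r.
by rewrite -addrA; apply: spanDl => //; exact: ih.
Qed.

Lemma span_sum (I : Type) (r : seq I) (P : pred I) (f : I -> V) :
  (forall i, P i -> span G (f i)) -> span G (\sum_(i <- r | P i) f i).
Proof.
by move=> h; elim/big_ind: _ => //; [exact: span0 | exact: spanD].
Qed.

Lemma span_ind_add (P : set V) : P 0 -> (forall x y, P x -> P y -> P (x + y)) ->
  G `<=` P -> span G `<=` P.
Proof. by move=> P0 PD GP x; elim=> // g y /GP Pg _; apply: PD. Qed.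
End Span.

Lemma span_map (V W : nmodType) (f : V -> W) (G : set V) (H : set W) :
  f 0 = 0 -> {morph f : x y / x + y} ->
  (forall g, G g -> span H (f g)) -> forall x, span G x -> span H (f x).
Proof.
move=> f0 fD GH x; elim=> [|g y Gg _ ih]; first by rewrite f0; exact: span0.
by rewrite fD; apply: spanD => //; exact: GH.
Qed.

Lemma span_sub (V : nmodType) (G H : set V) : G `<=` span H ->
  span G `<=` span H.
Proof. by apply: span_ind_add; [exact: span0 | exact: spanD]. Qed.

(** * Hilbert's basis theorem for subrings of a fixed commutative ring *)

Section HilbertBasis.
Variable A : comNzRingType.
Implicit Types (B C I : set A) (gs hs : seq A).

Definition subring B :=
  [/\ B 1, forall x y, B x -> B y -> B (x - y)
    & forall x y, B x -> B y -> B (x * y)].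

(** Scalars enter through the spanning set, since [span] only adds: the [C]-linear combinations of
    [gs] are [span (multiples C gs)]. *)
Definition multiples C gs : set A :=
  [set z | exists c g, [/\ C c, g \in gs & z = c * g]].

Definition ideal_of B I :=
  [/\ I `<=` B, I 0, forall x y, I x -> I y -> I (x - y)
    & forall b x, B b -> I x -> I (b * x)].

Definition noetherian B := forall I, ideal_of B I ->
  exists gs, (forall g, g \in gs -> I g) /\ I `<=` span (multiples B gs).

Definition poly_over B (q : {poly A}) := forall i, B q`_i.

Definition adjoin B x : set A := [set z | exists2 q, poly_over B q & z = q.[x]].

Section Subring.
Variable B : set A.
Hypothesis hB : subring B.

Lemma subring1 : B 1. Proof. by case: hB. Qed.
Lemma subringB x y : B x -> B y -> B (x - y). Proof. by case: hB => _ + _; apply. Qed.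
Lemma subringM x y : B x -> B y -> B (x * y). Proof. by case: hB => _ _; apply. Qed.
Lemma subring0 : B 0. Proof. by rewrite -(subrr 1); apply: subringB; exact: subring1. Qed.
Lemma subringD x y : B x -> B y -> B (x + y).
Proof.
by move=> hx hy; rewrite -[y]opprK -[- y]add0r; do 2!apply: subringB => //; exact: subring0.
Qed.

Lemma subring_sum (I : Type) (r : seq I) (P : pred I) (f : I -> A) :
  (forall i, P i -> B (f i)) -> B (\sum_(i <- r | P i) f i).
Proof. by move=> h; elim/big_ind: _ => //; [exact: subring0 | exact: subringD]. Qed.

Lemma poly_overC c : B c -> poly_over B c%:P.
Proof. by move=> hc i; rewrite coefC; case: ifP => // _; exact: subring0. Qed.

Lemma poly_overX : poly_over B 'X.
Proof. by move=> i; rewrite coefX; case: eqP => _; [exact: subring1 | exact: subring0]. Qed.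

Lemma poly_overB p q : poly_over B p -> poly_over B q -> poly_over B (p - q).
Proof. by move=> hp hq i; rewrite coefB; apply: subringB. Qed.

Lemma poly_overM p q : poly_over B p -> poly_over B q -> poly_over B (p * q).
Proof. by move=> hp hq i; rewrite coefM; apply: subring_sum => j _; apply: subringM. Qed.

Lemma poly_overXn n : poly_over B 'X^n.
Proof.
elim: n => [|n ih]; first by rewrite expr0; apply: poly_overC; exact: subring1.
by rewrite exprS; apply: poly_overM => //; exact: poly_overX.
Qed.

Lemma subring_adjoin x : subring (adjoin B x).
Proof.
split.
- by exists 1%:P; [apply: poly_overC; exact: subring1 | rewrite hornerC].
- move=> _ _ [p hp ->] [q hq ->]; exists (p - q); last by rewrite hornerD hornerN.
  exact: poly_overB.
- by move=> _ _ [p hp ->] [q hq ->]; exists (p * q); [exact: poly_overM | rewrite hornerM].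
Qed.

Lemma sub_adjoin x : B `<=` adjoin B x.
Proof. by move=> b hb; exists b%:P; [exact: poly_overC | rewrite hornerC]. Qed.

Lemma mem_adjoin x : adjoin B x x.
Proof. by exists 'X; [exact: poly_overX | rewrite hornerX]. Qed.

Lemma adjoin_sub x C : subring C -> B `<=` C -> C x -> adjoin B x `<=` C.
Proof.
move=> [C1 CB CM] BC Cx _ [q hq ->].
have C0 : C 0 by rewrite -(subrr 1); apply: CB.
have CD u v : C u -> C v -> C (u + v).
  by move=> hu hv; rewrite -[v]opprK -[- v]add0r; apply: (CB) => //; apply: CB.
rewrite horner_coef; elim/big_ind: _ => // i _; apply: (CM); first exact: BC.
by elim: (val i) => [|n ih]; rewrite ?expr0 // exprS; apply: (CM).
Qed.

Lemma multiplesZ gs b z : B b -> span (multiples B gs) z ->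
  span (multiples B gs) (b * z).
Proof.
move=> hb; apply: (span_map (mulr0 b) (mulrDr b)) => _ [c [g [hc hg ->]]].
by apply: span_gen; exists (b * c), g; split=> //; [exact: subringM | rewrite mulrA].
Qed.

End Subring.

Lemma multiples_mono B C gs hs : B `<=` C -> {subset gs <= hs} ->
  span (multiples B gs) `<=` span (multiples C hs).
Proof.
move=> BC gh; apply: span_sub => _ [c [g [hc hg ->]]].
by apply: span_gen; exists c, g; split=> //; [exact: BC | exact: gh].
Qed.

Section Adjoin.
Variables (B : set A) (x : A) (I : set A).
Hypotheses (hB : subring B) (hN : noetherian B) (hI : ideal_of (adjoin B x) I).

Definition lead_ideal n : set A :=
  [set b | exists q, [/\ poly_over B q, (size q <= n.+1)%N, q`_n = b & I q.[x]]].

Lemma lead_ideal_ideal n : ideal_of B (lead_ideal n).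
Proof.
have [_ I0 IB IM] := hI; split.
- by move=> _ [q [hq _ <- _]].
- exists 0; split; rewrite ?size_poly0 ?coef0 ?horner0 //.
  by move=> i; rewrite coef0; exact: subring0.
- move=> _ _ [p [hp sp <- Ip]] [q [hq sq <- Iq]]; exists (p - q); split.
  + exact: poly_overB.
  + by rewrite (leq_trans (size_polyD _ _)) // geq_max sp size_polyN.
  + by rewrite coefB.
  + by rewrite hornerD hornerN; exact: IB.
- move=> b _ hb [p [hp sp <- Ip]]; exists (b%:P * p); split.
  + by apply: poly_overM => //; exact: poly_overC.
  + by rewrite mul_polyC (leq_trans (size_scale_leq _ _)).
  + by rewrite coefCM.
  + by rewrite hornerM hornerC; apply: IM => //; exact: sub_adjoin.
Qed.

(** Multiplying by [x] raises the formal degree by one and keeps the top coefficient. *)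
Lemma lead_idealS n m : (n <= m)%N -> lead_ideal n `<=` lead_ideal m.
Proof.
have [_ I0 IB IM] := hI.
move=> /subnKC <-; elim: (m - n)%N => [|k ih] b hb; first by rewrite addn0.
have [q [hq sq eq Iq]] := ih _ hb; exists (q * 'X); split.
- by apply: poly_overM => //; exact: poly_overX.
- by rewrite (leq_trans (size_polyMleq _ _)) // size_polyX addn2 addnS ltnS.
- by rewrite addnS coefMX.
- by rewrite hornerM hornerX mulrC; apply: IM => //; exact: mem_adjoin.
Qed.

Lemma lead_ideal_bigcup : ideal_of B (\bigcup_n lead_ideal n).
Proof.
split.
- by move=> b [n _]; case: (lead_ideal_ideal n) => + _ _ _; apply.
- by exists 0%N => //; case: (lead_ideal_ideal 0).
- move=> a b [n _ ha] [m _ hb]; exists (maxn n m) => //.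
  case: (lead_ideal_ideal (maxn n m)) => _ _ + _; apply.
    by apply: lead_idealS ha; exact: leq_maxl.
  by apply: lead_idealS hb; exact: leq_maxr.
- move=> b a hb [n _ ha]; exists n => //.
  by case: (lead_ideal_ideal n) => _ _ _; apply.
Qed.

(** For each member of [bs], choose a polynomial with that coefficient at [X^n] and value in [I];
    [hs] lists the values. A [B]-combination of [bs] lifts to the same combination of these
    polynomials. *)
Lemma lead_lift n bs : (forall b, b \in bs -> lead_ideal n b) ->
  exists2 hs, (forall h, h \in hs -> I h) &
    forall b, span (multiples B bs) b -> exists r, [/\ poly_over B r,
      (size r <= n.+1)%N, r`_n = b & span (multiples B hs) r.[x]].
Proof.
elim: bs => [|b bs ih] hbs.
  exists [::] => // b; elim=> {b} [|g z [c [? []]]] //.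
  exists 0; split; rewrite ?size_poly0 ?coef0 ?horner0 //; last exact: span0.
  by move=> i; rewrite coef0; exact: subring0.
have [|hs hhs hhr] := ih; first by move=> c hc; apply: hbs; rewrite in_cons hc orbT.
have [q [hq sq eq Iq]] : lead_ideal n b by apply: hbs; rewrite mem_head.
exists (q.[x] :: hs) => [h|c].
  by rewrite in_cons => /predU1P[->|/hhs].
have hh : {subset hs <= q.[x] :: hs} by move=> h hh; rewrite in_cons hh orbT.
elim=> [|g z [c1 [g1 [hc1 hg1 ->]]] _ [r [hr sr er Ir]]].
  exists 0; split; rewrite ?size_poly0 ?coef0 ?horner0 //; last exact: span0.
  by move=> i; rewrite coef0; exact: subring0.
suff [r1 [hr1 sr1 er1 Ir1]] : exists r, [/\ poly_over B r,
      (size r <= n.+1)%N, r`_n = c1 * g1 & span (multiples B (q.[x] :: hs)) r.[x]].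
  exists (r1 + r); split.
  - by move=> i; rewrite coefD; apply: subringD.
  - by rewrite (leq_trans (size_polyD _ _)) // geq_max sr1.
  - by rewrite coefD er1 er.
  - by rewrite hornerD; exact: spanD.
move: hg1; rewrite in_cons => /predU1P[->|hg1].
  exists (c1%:P * q); split.
  + by apply: poly_overM => //; exact: poly_overC.
  + by rewrite mul_polyC (leq_trans (size_scale_leq _ _)).
  + by rewrite coefCM eq.
  + rewrite hornerM hornerC; apply: span_gen; exists c1, q.[x].
    by split; rewrite ?mem_head.
have [|r1 [hr1 sr1 er1 Ir1]] := hhr (c1 * g1).
  by apply: span_gen; exists c1, g1.
by exists r1; split=> //; apply: multiples_mono Ir1.
Qed.

(** Subtracting a lift of the top coefficient lowers the formal degree by one, and finitely many
    generators of [lead_ideal n] provide all the lifts. *)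
Lemma lead_reduce n : exists2 hs, (forall h, h \in hs -> I h) &
  forall q, poly_over B q -> (size q <= n.+1)%N -> I q.[x] ->
    exists r, [/\ poly_over B r, (size r <= n)%N, I r.[x] &
      span (multiples B hs) (q.[x] - r.[x])].
Proof.
have [bs [hbs Lbs]] := hN (lead_ideal_ideal n).
have [hs hhs hhr] := lead_lift hbs; exists hs => // q hq sq Iq.
have [|r [hr sr er Ir]] := hhr q`_n; first by apply: Lbs; exists q.
have [_ I0 IB IM] := hI.
have Irx : I r.[x].
  move: Ir; apply: span_ind_add => // [u v hu hv|_ [c [g [hc hg ->]]]].
    by rewrite -[v]opprK -[- v]add0r; apply: (IB) => //; apply: IB.
  by apply: IM; [exact: sub_adjoin | exact: hhs].
exists (q - r); split.
- exact: poly_overB.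
- apply/leq_sizeP => j; rewrite leq_eqVlt => /predU1P[<-|nj].
    by rewrite coefB er subrr.
  by rewrite coefB !(leq_sizeP _ _ _ j nj) ?subrr.
- by rewrite hornerD hornerN; exact: IB.
- by rewrite hornerD hornerN opprB addrCA subrr addr0.
Qed.

(** From some degree [N] on, lifts of generators of the union of all leading ideals suffice, after
    multiplication by powers of [x]. Each of the finitely many lower degrees contributes its own
    list. *)
Lemma noetherian_adjoin_ideal : exists gs, (forall g, g \in gs -> I g) /\
  I `<=` span (multiples (adjoin B x) gs).
Proof.
have [IA I0 IB IM] := hI.
have [bs [hbs Lbs]] := hN lead_ideal_bigcup.
(* The ideals increase with the degree, so finitely many elements of the union lie in a single
   one. *)
have [N hN'] : exists N, forall b, b \in bs -> lead_ideal N b.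
  elim: bs hbs {Lbs} => [|b bs ih] hbs; first by exists 0%N.
  have [N hN'] := ih (fun c hc => hbs c (mem_behead (s := b :: bs) hc)).
  have [M _ hM] := hbs b (mem_head _ _).
  exists (maxn N M) => c; rewrite in_cons => /predU1P[->|/hN' hc].
    by apply: lead_idealS hM; exact: leq_maxr.
  by apply: lead_idealS hc; exact: leq_maxl.
have [hs hhs hhr] := lead_lift hN'.
have hA := subring_adjoin hB x.
have low d : exists2 gs, (forall g, g \in gs -> I g) &
    forall q, poly_over B q -> (size q <= d)%N -> I q.[x] ->
      span (multiples (adjoin B x) gs) q.[x].
  elim: d => [|d [gs hgs ih]].
    exists [::] => // q _; rewrite leqn0 size_poly_eq0 => /eqP -> _.
    by rewrite horner0; exact: span0.
  have [ks hks hkr] := lead_reduce d.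
  exists (ks ++ gs) => [g|q hq sq Iq]; first by rewrite mem_cat => /orP[/hks|/hgs].
  have [r [hr sr Ir hqr]] := hkr q hq sq Iq.
  rewrite -(subrK r.[x] q.[x]); apply: spanD.
    apply: multiples_mono hqr; first exact: sub_adjoin.
    by move=> g hg; rewrite mem_cat hg.
  apply: multiples_mono (ih r hr sr Ir) => //.
  by move=> g hg; rewrite mem_cat hg orbT.
have [gs hgs hgr] := low N; exists (hs ++ gs); split=> [g|].
  by rewrite mem_cat => /orP[/hhs|/hgs].
suff main d q : poly_over B q -> (size q <= d)%N -> I q.[x] ->
    span (multiples (adjoin B x) (hs ++ gs)) q.[x].
  by move=> z Iz; have [q hq ez] := IA _ Iz; rewrite ez in Iz *; exact: (main (size q)).
elim: d q => [|d ih] q hq sq Iq.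
  move: sq; rewrite leqn0 size_poly_eq0 => /eqP ->.
  by rewrite horner0; exact: span0.
have [dN|Nd] := ltnP d N.
  apply: multiples_mono (hgr q hq (leq_trans sq dN) Iq) => //.
  by move=> g hg; rewrite mem_cat hg orbT.
have [|r [hr sr er Ir]] := hhr q`_d.
  by apply: Lbs; exists d => //; exists q.
(* The lift [r] has formal degree [N]; the shift aligns its top coefficient with that of [q], of
   formal degree [d]. *)
set r' := r * 'X^(d - N).
have Irx : I r.[x].
  move: Ir; apply: span_ind_add => // [u v hu hv|_ [c [g [hc hg ->]]]].
    by rewrite -[v]opprK -[- v]add0r; apply: (IB) => //; apply: IB.
  by apply: IM; [exact: sub_adjoin | exact: hhs].
have xn : adjoin B x (x ^+ (d - N)).
  by exists 'X^(d - N); [exact: poly_overXn | rewrite hornerXn].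
have er' : r'.[x] = x ^+ (d - N) * r.[x] by rewrite hornerM hornerXn mulrC.
rewrite -(subrK r'.[x] q.[x]); apply: spanD.
  rewrite -hornerN -hornerD; apply: ih.
  - by apply: poly_overB => //; apply: poly_overM => //; exact: poly_overXn.
  - apply/leq_sizeP => j; rewrite leq_eqVlt => /predU1P[<-|nj].
      by rewrite coefB coefMXn ltnNge leq_subr /= subKn // er subrr.
    rewrite coefB coefMXn ltnNge (leq_trans (leq_subr _ _) (ltnW nj)) /=.
    rewrite (nth_default _ (leq_trans sq nj)) nth_default ?subrr //; apply: (leq_trans sr).
    by rewrite ltn_subRL subnK.
  - rewrite hornerD hornerN er'; apply: IB => //; exact: IM.
rewrite er'; apply: multiplesZ => //.
apply: multiples_mono Ir; first exact: sub_adjoin.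
by move=> g hg; rewrite mem_cat hg.
Qed.

End Adjoin.

(* Hilbert's argument on leading coefficients does not need [x] to be
   transcendental over [B]: leading coefficients are taken over all polynomial
   expressions of an element. *)
Lemma noetherian_adjoin B x : subring B -> noetherian B -> noetherian (adjoin B x).
Proof. by move=> hB hN I hI; exact: noetherian_adjoin_ideal. Qed.

Definition adjoins B xs := foldr (fun x C => adjoin C x) B xs.

Lemma adjoinsP B xs : subring B -> noetherian B ->
  [/\ subring (adjoins B xs), noetherian (adjoins B xs), B `<=` adjoins B xs &
      forall x, x \in xs -> adjoins B xs x].
Proof.
move=> hB hN; elim: xs => [|x xs [h1 h2 h3 h4]]; first by split.
split; [exact: subring_adjoin | exact: noetherian_adjoin | | ].
- by move=> b /h3; exact: sub_adjoin.
- by move=> y; rewrite in_cons => /predU1P[->|/h4]; [exact: mem_adjoin | exact: sub_adjoin].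
Qed.

Lemma adjoins_sub B xs C : subring C -> B `<=` C ->
  (forall x, x \in xs -> C x) -> adjoins B xs `<=` C.
Proof.
move=> hC BC; elim: xs => //= x xs ih hxs; apply: adjoin_sub => //.
  by apply: ih => y hy; apply: hxs; rewrite in_cons hy orbT.
by apply: hxs; rewrite mem_head.
Qed.

(** A nonzero element of an ideal generates it, and the zero ideal needs no generator. *)
Lemma noetherian_field B : subring B ->
  (forall b, B b -> b <> 0 -> exists2 c, B c & c * b = 1) -> noetherian B.
Proof.
move=> hB hV I [IB I0 _ IM].
have [[b [Ib b0]]|I00] := pselect (exists b, I b /\ b <> 0).
  have [c hc cb] := hV b (IB _ Ib) b0.
  exists [:: b]; split=> [g|z /IB hz]; first by rewrite inE => /eqP ->.
  apply: span_gen; exists (z * c), b; split; rewrite ?mem_head //; first exact: subringM.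
  by rewrite -mulrA cb mulr1.
exists [::]; split=> // z Iz; have -> : z = 0; last exact: span0.
by apply: contrapT => z0; apply: I00; exists z.
Qed.

End HilbertBasis.

(** * Graded commutative rings and the Rees ring of the degree filtration *)

(** An internal grading, given by its projections, so that components need no types of their own:
    [x] is homogeneous of degree [n] when [pr n x = x]. *)
Record grading (A : comNzRingType) := Grading {
  pr :> nat -> A -> A;
  prB : forall n, {morph pr n : x y / x - y};
  prM : forall n x y, pr n (x * y) = \sum_(i < n.+1) pr i x * pr (n - i)%N y;
  pr_pr : forall m n x, pr m (pr n x) = if m == n then pr n x else 0;
  pr1 : pr 0%N 1 = 1;
  pr_finite : forall x, exists N, x = \sum_(n < N) pr n x
}.

Section Graded.
Variables (A : comNzRingType) (g : grading A).
Implicit Types (x y a b : A) (ys : seq A).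

Lemma pr0 n : g n 0 = 0.
Proof. by have := prB g n 0 0; rewrite !subrr. Qed.

Lemma prD n : {morph g n : x y / x + y}.
Proof.
have prN y : g n (- y) = - g n y by rewrite -[- y]add0r prB pr0 add0r.
by move=> x y; rewrite -{1}[y]opprK prB prN opprK.
Qed.

Lemma pr_id n x : g n (g n x) = g n x.
Proof. by rewrite pr_pr eqxx. Qed.

Lemma pr_1S n : g n.+1 1 = 0.
Proof. by rewrite -(pr1 g) pr_pr. Qed.

Lemma pr_bounded x : exists N, forall n, (N <= n)%N -> g n x = 0.
Proof.
have [N eN] := pr_finite g x; exists N => n Nn; rewrite eN.
rewrite (big_morph (g n) (prD n) (pr0 n)) big1 // => i _.
by rewrite pr_pr gtn_eqF // (leq_trans (ltn_ord i)).
Qed.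

Lemma pr_mul i j x y : g (i + j)%N (g i x * g j y) = g i x * g j y.
Proof.
have ij : (i < (i + j).+1)%N by rewrite ltnS leq_addr.
rewrite prM (bigD1 (Ordinal ij)) //= !pr_pr eqxx addKn eqxx big1 ?addr0 // => k.
by rewrite -val_eqE /= pr_pr => /negbTE ->; rewrite mul0r.
Qed.

(* [hmultiples m ys] generates the degree [m + d] part of the ideal spanned by
   elements [ys] of degree [d]. *)
Definition hmultiples m ys : set A :=
  [set z | exists c y, y \in ys /\ z = g m c * y].

Lemma hmultiplesZ i m ys c z : span (hmultiples m ys) z ->
  span (hmultiples (i + m)%N ys) (g i c * z).
Proof.
apply: (span_map (mulr0 _) (mulrDr _)) => _ [b [y [hy ->]]].
by apply: span_gen; exists (g i c * g m b), y; rewrite pr_mul mulrA.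
Qed.

Definition generated_over_pr0 (X : set A) := forall B : set A,
  B 1 -> (forall x y, B x -> B y -> B (x - y)) ->
  (forall x y, B x -> B y -> B (x * y)) ->
  (forall c x, B x -> B (g 0%N c * x)) -> X `<=` B -> forall x, B x.

(** In terms of components, A_(m+1) = A_m ys for all [m]: the form suited to induction on the
    degree. *)
Definition degree1_generators ys := (forall y, y \in ys -> g 1%N y = y) /\
  forall m x, span (hmultiples m ys) (g m.+1 x).

Lemma hmultiplesN m ys x : span (hmultiples m ys) x -> span (hmultiples m ys) (- x).
Proof.
apply: (@span_map A A -%R _ _ (@oppr0 A) (@opprD A)) => _ [c [y [hy ->]]].
by apply: span_gen; exists (0 - c), y; split=> //; rewrite prB pr0 add0r mulNr.
Qed.

(** Since (xy)_1 = x_0 y_1 + x_1 y_0, the degree 1 components of the algebra generators [xs] span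
    A_1 over A_0. In degree [m + 1], every term of the product formula has a factor of positive
    degree, from which a member of [ys] splits off. *)
Lemma exists_degree1_generators (xs : seq A) :
  generated_over_pr0 [set` xs] -> generated_over_pr0 [set x | g 1%N x = x] ->
  exists ys, degree1_generators ys.
Proof.
move=> hxs h1; set ys := map (g 1%N) xs; exists ys.
have ys1 y : y \in ys -> g 1%N y = y by move=> /mapP[x _ ->]; rewrite pr_id.
(* The elements whose degree 1 component has this form are closed under the algebra operations and
   contain [xs]. *)
have span1 x : span (hmultiples 0 ys) (g 1%N x).
  move: x; apply: hxs.
  - by rewrite pr_1S; exact: span0.
  - by move=> x y hx hy; rewrite prB; apply: spanD => //; exact: hmultiplesN.
  - move=> x y hx hy; rewrite prM !big_ord_recl big_ord0 /= addr0 subn0 subnn.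
    by apply: spanD; last rewrite mulrC; exact: (@hmultiplesZ 0 0).
  - move=> c x hx; rewrite prM !big_ord_recl big_ord0 /= addr0 subn0 subnn.
    rewrite pr_id pr_pr mul0r addr0; exact: (@hmultiplesZ 0 0).
  - move=> x /= hx; apply: span_gen; exists 1, (g 1%N x).
    by rewrite pr1 mul1r map_f.
(* The same closure argument with generation in degree 1, for all [m] at once because a product
   involves lower degrees of its factors. *)
split=> // m x; move: x m; apply: h1.
- by move=> m; rewrite pr_1S; exact: span0.
- by move=> x y hx hy m; rewrite prB; apply: spanD => //; exact: hmultiplesN.
- move=> x y hx hy m; rewrite prM big_ord_recr /= subnn.
  (* In the last summand x_(m+1) y_0 only the left factor has positive degree, so commutativity is
     used. *)
  apply: spanD; last by rewrite mulrC; exact: (@hmultiplesZ 0).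
  apply: span_sum => i _; rewrite subSn -1?ltnS ?ltn_ord //.
  by have := @hmultiplesZ i (m - i) ys x _ (hy (m - i)%N); rewrite subnKC // -ltnS.
- move=> c x hx m; rewrite prM big_ord_recl /= subn0 pr_id big1 => [|i _].
    by rewrite addr0; exact: (@hmultiplesZ 0).
  by rewrite pr_pr mul0r.
- move=> x /= <- [|m]; first by rewrite pr_id; exact: span1.
  by rewrite pr_pr; exact: span0.
Qed.

(** The list [ws] consists of the products of [j] members of [ys]. *)
Lemma degreej_generators ys j : degree1_generators ys ->
  exists ws, (forall w, w \in ws -> g j w = w) /\
    forall m x, span (hmultiples m ws) (g (m + j)%N x).
Proof.
move=> [ys1 hys]; elim: j => [|j [ws [wsj hws]]].
  exists [:: 1]; split=> [w|m x]; first by rewrite inE => /eqP ->; rewrite pr1.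
  by rewrite addn0; apply: span_gen; exists x, 1; rewrite mem_head mulr1.
exists [seq w * y | w <- ws, y <- ys]; split=> [_ /allpairsP[[w y] /= [hw hy ->]]|m x].
  by rewrite -(wsj w hw) -(ys1 y hy) -addn1 pr_mul.
rewrite addnS; apply: span_sub (hys (m + j)%N x) => _ [c [y [hy ->]]].
apply: (span_map (mul0r y) (fun a b => mulrDl a b y)) (hws m c) => _ [b [w [hw ->]]].
apply: span_gen; exists b, (w * y); rewrite mulrA; split=> //.
by apply/allpairsP; exists (w, y).
Qed.

(* The Rees ring of the filtration of [A] by degree. *)
Definition graded_rees : set {poly A} :=
  [set p | forall n m, (m < n)%N -> g m p`_n = 0].

Lemma graded_rees_subring : subring graded_rees.
Proof.
split=> [[|n] m //|p q hp hq n m mn|p q hp hq n m mn].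
- by rewrite coef1 pr0.
- by rewrite coefB prB hp // hq // subrr.
- rewrite coefM (big_morph (g m) (prD m) (pr0 m)) big1 // => i _.
  rewrite prM big1 // => j _.
  have [ji|ij] := ltnP j i; first by rewrite hp // mul0r.
  rewrite hq ?mulr0 // ltn_subLR ?leq_ord // (leq_trans mn) //.
  by rewrite -{1}(subnKC (leq_ord i)) leq_add2r.
Qed.

Definition graded_consts : set {poly A} := [set p | exists c, p = (g 0%N c)%:P].

Lemma graded_consts_subring : subring graded_consts.
Proof.
split.
- by exists 1; rewrite pr1.
- by move=> _ _ [a ->] [b ->]; exists (a - b); rewrite prB polyCB.
- by move=> _ _ [a ->] [b ->]; exists (g 0%N a * g 0%N b); rewrite (@pr_mul 0 0) polyCM.
Qed.

(** An element of degree [m] is an A_0-combination of products of [m] degree 1 generators, and for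
    [n <= m] the factor [X^n] can be spread over [n] of them. *)
Lemma graded_rees_eq ys : degree1_generators ys ->
  graded_rees = adjoins graded_consts ([seq y%:P | y <- ys] ++ [seq y *: 'X | y <- ys]).
Proof.
move=> [ys1 hys]; set xs := _ ++ _; apply/seteqP; split; last first.
  apply: adjoins_sub => [||x].
  - exact: graded_rees_subring.
  - move=> _ [c ->] [|n] m //; by rewrite coefC pr0.
  - rewrite mem_cat => /orP[] /mapP[y /ys1 y1 ->] n m.
      by rewrite coefC; case: n => //=; rewrite pr0.
    rewrite coefZ coefX; case: n => [|[|n]] //= mn; rewrite ?mulr0 ?pr0 //.
    by rewrite mulr1 -y1 pr_pr ltn_eqF.
have [] : [/\ subring (adjoins graded_consts xs), graded_consts `<=` adjoins graded_consts xs
    & forall p, p \in xs -> adjoins graded_consts xs p].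
  elim: (xs) => [|x l [h1 h2 h3]]; first by split=> //; exact: graded_consts_subring.
  split; [exact: subring_adjoin | by move=> b /h2; exact: sub_adjoin | move=> y].
  by rewrite in_cons => /predU1P[->|/h3]; [exact: mem_adjoin | exact: sub_adjoin].
move: (adjoins _ _) => T hT T0 Txs.
have mono m n a : (n <= m)%N -> T (g m a *: 'X^n).
  elim: m n a => [|m ih] n a.
    by rewrite leqn0 => /eqP ->; rewrite expr0 alg_polyC; apply: T0; exists a.
  move=> nm; elim: (hys m a) => [|_ x [c [y [hy ->]]] _ hx].
    by rewrite scale0r; exact: subring0.
  rewrite scalerDl; apply: subringD => //.
  (* When the exponent equals the degree, the generator split off must carry an [X]; otherwise it is
     split off as a constant. *)
  move: nm; rewrite leq_eqVlt => /predU1P[->|nm].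
    rewrite mulrC exprS -scalerA scalerAr scalerAl; apply: subringM => //; last exact: ih.
    by apply: Txs; rewrite mem_cat (map_f (fun y => y *: 'X)) ?orbT.
  rewrite mulrC -scalerA -mul_polyC; apply: subringM => //; last exact: ih.
  by apply: Txs; rewrite mem_cat (map_f polyC).
move=> p hp; rewrite -[p]coefK poly_def; apply: subring_sum => // i _.
have [N ->] := pr_finite g p`_i.
rewrite scaler_suml; apply: subring_sum => // m _.
(* Components of degree below the exponent of [X] vanish by the definition of [graded_rees]. *)
have [/hp ->|im] := ltnP m i; last exact: mono.
by rewrite scale0r; exact: subring0.
Qed.

Lemma graded_rees_noetherian ys : degree1_generators ys ->
  (forall c, g 0%N c <> 0 -> exists b, g 0%N b * g 0%N c = 1) ->
  noetherian graded_rees.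
Proof.
move=> hys hV; rewrite (graded_rees_eq hys).
have hC : noetherian graded_consts.
  apply: noetherian_field => [|_ [c ->] c0]; first exact: graded_consts_subring.
  have [c0'|b bc] := hV c; first by apply: c0; rewrite c0'.
  by exists (g 0%N b)%:P; [exists b | rewrite -polyCM bc].
by case: (adjoinsP ([seq y%:P | y <- ys] ++ [seq y *: 'X | y <- ys]) graded_consts_subring hC).
Qed.

End Graded.

(** * The associated graded ring: commutative structure and principal symbols *)

Section ComRing.
Variable A : naRingType.
Hypotheses (hA : associative ( *%g : A -> A -> A)).
Hypotheses (hC : commutative ( *%g : A -> A -> A)) (h1 : (1%g : A) != 0).

(** The operations are kept, so identities for [**] become identities for [*] by conversion. *)
Definition comring : comNzRingType :=
  HB.pack_for comNzRingType (NARing.sort A)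
    (GRing.Zmodule_isComNzRing.Build (NARing.sort A) hA hC (@mul1g A) (@namulDl A) h1).
End ComRing.

Section Symbols.
Variables (R : naRingType) (F : filtration R).
Implicit Types (x y : R) (a b : gr F).

(** A total map to [F k], with value 0 outside, so that symbols are written without membership
    proofs. *)
Definition clip k x : filt_sub F k := insubd 0 x.

Lemma val_clip k x : x \in F k -> val (clip k x) = x.
Proof. exact: insubdK. Qed.

Lemma gr_comp_exists k (c : gr_comp F k) : exists2 x, x \in F k & c = gr_class (clip k x).
Proof.
exists (val (gr_repr c)); first exact: valP.
by rewrite -[LHS]gr_reprK; congr gr_class; apply: val_inj; rewrite val_clip ?(valP (gr_repr c)).
Qed.

Lemma gr_class_eq0 k x : x \in F k ->
  (gr_class (clip k x) = 0) <-> (x \in F k.+1).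
Proof.
move=> hx; have -> : 0 = gr_class (0 : filt_sub F k) by rewrite /gr_class raddf0.
by split=> [/gr_classP|h]; [|apply/gr_classP]; rewrite val_clip // subr0.
Qed.

(** Taking a whole family [c], of which only the value at [n] counts, avoids a transport along
    [k = n]. *)
Definition gr_single n (c : forall k, gr_comp F k) k : gr_graded F k :=
  if k == n then c k else 0.

Lemma gr_single_subproof n c : exists N, forall k, (N <= k)%N -> gr_single n c k = 0.
Proof. by exists n.+1 => k nk; rewrite /gr_single gtn_eqF. Qed.

Definition gr_pr n a : gr F := DSum (gr_single_subproof n a).

(* The principal symbol of degree [n] of an element of [F n]; the value on other
   elements is irrelevant. *)
Definition gr_sym n x : gr F :=
  DSum (gr_single_subproof n (fun k => gr_class (clip k x))).

Lemma gr_symB n x y : x \in F n -> y \in F n ->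
  gr_sym n (x - y) = gr_sym n x - gr_sym n y.
Proof.
move=> hx hy; apply: dsumP => k; rewrite /= /gr_single; case: eqP => [->|_]; last by rewrite subr0.
rewrite -raddfB; congr gr_class; apply: val_inj.
by rewrite raddfB /= !val_clip // rpredB.
Qed.

Lemma gr_sym0 n : gr_sym n 0 = 0.
Proof. by have := @gr_symB n 0 0 (rpred0 _) (rpred0 _); rewrite !subrr. Qed.

Lemma gr_symD n x y : x \in F n -> y \in F n ->
  gr_sym n (x + y) = gr_sym n x + gr_sym n y.
Proof.
move=> hx hy; have hy' : - y \in F n by rewrite rpredN.
have := gr_symB (rpred0 (F n)) hy; rewrite sub0r gr_sym0 sub0r => eN.
by rewrite -{1}[y]opprK gr_symB // eN opprK.
Qed.

Lemma gr_sym_eq0 n x : x \in F n -> gr_sym n x = 0 -> x \in F n.+1.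
Proof.
move=> hx h0; apply/(gr_class_eq0 hx).
by have := congr1 (fun a : gr F => a n) h0; rewrite /= /gr_single eqxx.
Qed.

Lemma gr_sym_inj n x y : x \in F n -> y \in F n -> gr_sym n x = gr_sym n y ->
  x - y \in F n.+1.
Proof.
by move=> hx hy exy; apply: gr_sym_eq0; rewrite ?rpredB // gr_symB // exy subrr.
Qed.

Lemma gr_symM i j x y : x \in F i -> y \in F j ->
  gr_sym i x ** gr_sym j y = gr_sym (i + j)%N (x ** y).
Proof.
move=> hx hy; apply: dsumP => k; rewrite /= /dsum_mul_coord /= /gr_single.
case: eqP => [->|kij]; last first.
  apply: big1 => l _; case: eqP => [li|_]; last exact: (@gmul0l (gr_graded F)).
  case: eqP => [kl|_]; last exact: (@gmul0r (gr_graded F)).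
  by case: kij; rewrite -kl -li subnKC // leq_ord.
have ij : (i < (i + j).+1)%N by rewrite ltnS leq_addr.
rewrite (bigD1 (Ordinal ij)) //= big1 ?addr0 => [|l]; last first.
  by rewrite -val_eqE /= => /negbTE ->; exact: (@gmul0l (gr_graded F)).
rewrite eqxx; move: (subnKC _) => /=; rewrite addKn eqxx => e.
rewrite [LHS]gr_mulE; congr gr_class; apply: val_inj.
by rewrite /= !val_clip //; exact: mem_filtM hx hy.
Qed.

Lemma gr_prB n a b : gr_pr n (a - b) = gr_pr n a - gr_pr n b.
Proof.
by apply: dsumP => k; rewrite /= /gr_single; case: eqP => // _; rewrite subr0.
Qed.

Lemma gr_pr_pr m n a : gr_pr m (gr_pr n a) = if m == n then gr_pr n a else 0.
Proof.
case: eqVneq => [->|/eqP mn]; apply: dsumP => k; rewrite /= /gr_single.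
  by case: eqP.
by case: eqP => // ->; case: eqP.
Qed.

Lemma gr_pr_sym m n x : gr_pr m (gr_sym n x) = if m == n then gr_sym n x else 0.
Proof.
case: eqVneq => [->|/eqP mn]; apply: dsumP => k; rewrite /= /gr_single.
  by case: eqP.
by case: eqP => // ->; case: eqP.
Qed.

Lemma dsum_sum_coord (I : Type) (r : seq I) (f : I -> gr F) k :
  (\sum_(i <- r) f i) k = \sum_(i <- r) f i k.
Proof. by elim/big_rec2: _ => // i y1 y2 _ <-. Qed.

Lemma gr_prM n a b :
  gr_pr n (a ** b) = \sum_(i < n.+1) gr_pr i a ** gr_pr (n - i)%N b.
Proof.
apply: dsumP => k; rewrite dsum_sum_coord /= /dsum_mul_coord /= /gr_single.
case: eqP => [->|kn].
  rewrite /dsum_mul_coord; apply: eq_bigr => i _.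
  rewrite (bigD1 i) //= !eqxx big1 ?addr0 // => j.
  by rewrite -val_eqE /= => /negbTE ->; exact: (@gmul0l (gr_graded F)).
rewrite big1 // => i _; rewrite big1 // => j _.
case: eqP => [ji|_]; last exact: (@gmul0l (gr_graded F)).
case: eqP => [kj|_]; last exact: (@gmul0r (gr_graded F)).
by case: kn; rewrite -(subnKC (leq_ord j)) kj ji subnKC // leq_ord.
Qed.

Lemma gr_pr1 : gr_pr 0 1%g = 1%g.
Proof. by apply: dsumP => -[|k]. Qed.

Lemma gr_sym1 : gr_sym 0 1%g = 1%g.
Proof.
apply: dsumP => -[|k] //; congr gr_class; apply: val_inj.
by rewrite val_clip ?mem_filt0.
Qed.

Lemma gr_pr_finite a : exists N, a = \sum_(n < N) gr_pr n a.
Proof.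
have [N hN] := coord_finite a; exists N; apply: dsumP => k.
rewrite dsum_sum_coord /= /gr_single; have [kN|/hN ->] := ltnP k N.
  rewrite (bigD1 (Ordinal kN)) //= eqxx big1 ?addr0 // => i.
  by rewrite -val_eqE /= eq_sym => /negbTE ->.
by rewrite big1 // => i _; case: eqP.
Qed.

Lemma gr_pr_is_sym n a : exists2 x, x \in F n & gr_pr n a = gr_sym n x.
Proof.
have [x hx ex] := gr_comp_exists (a n); exists x => //; apply: dsumP => k.
by rewrite /= /gr_single; case: eqP => // ->.
Qed.

End Symbols.

(** * Linear combinations with coefficients in prescribed sets *)

Section Coefficients.
Variables (S : naRingType) (I : eqType) (ws : seq I) (f : I -> S) (C : I -> set S).
Hypotheses (C0 : forall i, C i 0) (CD : forall i a b, C i a -> C i b -> C i (a + b)).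

Definition combinations : set S :=
  [set z | exists i s, [/\ i \in ws, C i s & z = s ** f i]].

(** Coefficients attached to the same index are added up by distributivity alone; [undup] leaves one
    coefficient per index. *)
Lemma span_coefficients y : span combinations y ->
  exists2 s : I -> S, (forall i, C i (s i)) & y = \sum_(i <- undup ws) s i ** f i.
Proof.
elim=> [|_ z [i [c [iw hc ->]]] _ [s hs ->]].
  by exists (fun=> 0) => //; rewrite big1 // => i _; rewrite namul0r.
exists (fun j => if j == i then c + s j else s j) => [j|].
  by case: eqP => // ->; exact: CD.
have iu : i \in undup ws by rewrite mem_undup.
rewrite (bigD1_seq i) ?undup_uniq //= [RHS](bigD1_seq i) ?undup_uniq //= eqxx.
rewrite namulDl addrA; congr (_ + _); apply: eq_bigr => j /negbTE ->.
by [].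
Qed.

Lemma span_combination (s : I -> S) : (forall i, C i (s i)) ->
  span combinations (\sum_(i <- undup ws) s i ** f i).
Proof.
move=> hs; rewrite big_seq; apply: span_sum => i; rewrite mem_undup => iw.
by apply: span_gen; exists i, (s i).
Qed.
End Coefficients.

Lemma left_ideal_sum (S : naRingType) (I : set S) (T : Type) (r : seq T)
  (P : pred T) (f : T -> S) : left_ideal I -> (forall i, P i -> I (f i)) ->
  I (\sum_(i <- r | P i) f i).
Proof.
move=> [I0 IB _] h; elim/big_ind: _ => // x y hx hy.
by rewrite -[y]opprK -[- y]add0r; apply: (IB) => //; apply: IB.
Qed.

Lemma finitely_spanned_seq (S : naRingType) (I : set S) (gs : seq S) :
  left_ideal I -> (forall g, g \in gs -> I g) ->
  I `<=` span (combinations gs id (fun=> setT)) -> finitely_spanned I.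
Proof.
move=> hI hgs hspan; exists (size (undup gs)), (tnth (in_tuple (undup gs))).
have hg i : I (tnth (in_tuple (undup gs)) i).
  by apply: hgs; rewrite -mem_undup; exact: mem_tnth.
split=> //; apply/seteqP; split=> [y /hspan hy|y [s ->]].
  have [//|//|s _ ->] := span_coefficients _ _ hy.
  by exists (fun i => s (tnth (in_tuple (undup gs)) i)); rewrite big_tnth.
by apply: left_ideal_sum => // i _; case: hI => _ _; apply.
Qed.

(** * Limits and successive approximation in a complete filtered ring *)

Section Completeness.
Variables (R : naRingType) (F : filtration R).
Hypothesis hF : complete F.

Lemma complete_hausdorff x : (forall i, x \in F i) -> x = 0.
Proof.
move=> hx; apply: (bij_inj hF); apply: eq_exist.
by apply: functional_extensionality_dep => i; apply/quot_piP; rewrite subr0.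
Qed.

(** The classes of the [u i] form a point of the inverse limit, and surjectivity of the natural map
    gives a preimage. *)
Lemma complete_limit (u : nat -> R) :
  (forall i j, (i <= j)%N -> u j - u i \in F i) ->
  exists v, forall i, v - u i \in F i.
Proof.
move=> hu; have [lim _ limK] := hF.
have sub i j : (i <= j)%N ->
    quot_proj i (\pi_{ideal_quot F j} (u j)) = \pi_{ideal_quot F i} (u i).
  by move=> ij; rewrite to_inverse_limit_subproof //; apply/quot_piP; exact: hu.
exists (lim (exist _ _ sub)) => i; apply/quot_piP.
by have /(congr1 (fun z : inverse_limit F => sval z i)) := limK (exist _ _ sub).
Qed.

(* Successive approximation: the correction terms have coefficients in
   [F (m - D)], so they can be summed by completeness. *)
Lemma lift_span (I : eqType) (ws : seq I) (f : I -> R) (e : I -> nat)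
    (V : set R) m0 D :
  (forall m x, (m0 <= m)%N -> V x -> x \in F m -> exists y,
    [/\ span (combinations ws f [fun i => [set s | s \in F (e i) /\ s \in F (m - D)%N]]) y,
        V (x - y) & x - y \in F m.+1]) ->
  forall x, V x -> x \in F m0 ->
    span (combinations ws f [fun i => [set s | s \in F (e i)]]) x.
Proof.
move=> step.
(* Coefficients of one correction step are fixed for all pairs [(m, x)], with 0 where the step does
   not apply. *)
have /choice[S hS] : forall mx : nat * R, exists s : I -> R,
    (m0 <= mx.1)%N -> V mx.2 -> mx.2 \in F mx.1 ->
    let y := \sum_(i <- undup ws) s i ** f i in
    [/\ forall i, s i \in F (e i) /\ s i \in F (mx.1 - D)%N, V (mx.2 - y) &
        mx.2 - y \in F mx.1.+1].
  move=> [m x]; have [[hm hV hx]|h] := pselect [/\ (m0 <= m)%N, V x & x \in F m].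
    have [y [hy Vy Fy]] := step m x hm hV hx.
    have [i|i a b [ha ha'] [hb hb']|s hs ey] := span_coefficients _ _ hy.
    - by split; exact: rpred0.
    - by split; exact: rpredD.
    by exists s => _ _ _; rewrite /= -ey.
  by exists (fun=> 0) => hm hV hx; case: h.
move=> x Vx Fx.
(* Here [xs k] is the remainder after [k] corrections, [c k] gives the coefficients of the next one,
   and [u k] their partial sums. *)
pose xs := fix xs k := if k is k'.+1 then
  xs k' - \sum_(i <- undup ws) S ((m0 + k')%N, xs k') i ** f i else x.
pose c k i := S ((m0 + k)%N, xs k) i.
have hxs k : V (xs k) /\ xs k \in F (m0 + k)%N.
  elim: k => [|k [Vk Fk]]; first by rewrite addn0.
  by case: (hS ((m0 + k)%N, xs k) (leq_addr _ _) Vk Fk) => _ /=; rewrite addnS.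
have hc k i : c k i \in F (e i) /\ c k i \in F (m0 + k - D)%N.
  by case: (hxs k) => Vk Fk; case: (hS ((m0 + k)%N, xs k) (leq_addr _ _) Vk Fk) => /(_ i).
pose u k i := \sum_(j < k) c j i.
have hu k i : u k i \in F (e i) by apply: rpred_sum => j _; case: (hc j i).
have hxu k : xs k = x - \sum_(i <- undup ws) u k i ** f i.
  elim: k => [|k ih].
    by rewrite big1 ?subr0 // => i _; rewrite /u big_ord0 namul0r.
  rewrite /= [X in X - _]ih -addrA -opprD -big_split; congr (_ - _).
  by apply: eq_bigr => i _; rewrite /u big_ord_recr namulDl.
(* The coefficients of step [k] are only known to lie in [F (m0 + k - D)], so the Cauchy condition
   is stated after a shift by [D]. *)
have hlim i : exists v, forall k, v - u (k + D)%N i \in F k.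
  apply: complete_limit => k j kj.
  have -> : u (j + D)%N i - u (k + D)%N i = \sum_(k + D <= l < j + D) c l i.
    rewrite /u -!(big_mkord xpredT (fun l => c l i)).
    by rewrite (@big_cat_nat _ _ _ (k + D)%N) ?leq_add2r //= addrAC subrr add0r.
  rewrite big_nat_cond; apply: rpred_sum => l; rewrite andbT => /andP[kl _].
  case: (hc l i) => _; apply: filt_le.
  by rewrite -(addnK D k) leq_sub2r // (leq_trans kl) // leq_addl.
have /choice[v hv] := hlim.
suff -> : x = \sum_(i <- undup ws) v i ** f i.
  (* Modulo [F (e i)] the limit equals a partial sum, which lies in [F (e i)] itself. *)
  apply: span_combination => i /=; rewrite -[v i](subrK (u (e i + D)%N i)).
  by apply: rpredD.
apply/eqP; rewrite -subr_eq0; apply/eqP/complete_hausdorff => k.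
(* The error is a remainder minus a combination of tails, and both lie in [F k]. *)
have -> : x - \sum_(i <- undup ws) v i ** f i =
    xs (k + D)%N - \sum_(i <- undup ws) (v i - u (k + D)%N i) ** f i.
  rewrite hxu -addrA -opprD -big_split; congr (_ - _).
  by apply: eq_bigr => i _; rewrite /= -namulDl addrC subrK.
apply: rpredB.
  by case: (hxs (k + D)%N) => _; apply: filt_le; rewrite addnCA leq_addr.
by apply: rpred_sum => i _; apply: Defs.idealMr; exact: hv.
Qed.

End Completeness.

(** * Complete local-filtered rings: the maximal ideal and products of the ideals F^i *)

Section LocalFiltered.
Variables (R : naRingType) (F : filtration R).
Hypothesis hF : complete_local_filtered F.

Let F_complete : complete F. Proof. by case: hF. Qed.
Let K_field : na_is_field {ideal_quot F 1%N}. Proof. by case: hF. Qed.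
Let gr_mulA : associative ( *%g : gr F -> gr F -> gr F).
Proof. by case: hF => _ _ []. Qed.
Let gr_mulC : commutative ( *%g : gr F -> gr F -> gr F).
Proof. by case: hF => _ _ []. Qed.

Lemma one_notin_filt1 : 1%g \notin F 1%N.
Proof.
case: K_field => K10 _ _ _; apply/negP => h1; apply: K10.
by rewrite -[RHS](raddf0 \pi_{ideal_quot F 1%N}); apply/quot_piP; rewrite subr0.
Qed.

Lemma left_inverse_mod_filt1 x : x \notin F 1%N -> exists y, y ** x - 1%g \in F 1%N.
Proof.
case: K_field => _ _ KC KV hx.
have [|y] := KV (\pi_{ideal_quot F 1%N} x).
  move=> x0; case/negP: hx; rewrite -[x]subr0; apply/quot_piP.
  by rewrite raddf0.
rewrite KC -[y]reprK [LHS]quot_mulE => /quot_piP hy.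
by exists (repr y).
Qed.

Lemma gr_oner_neq0 : (1%g : gr F) != 0.
Proof.
apply/eqP => h; case/negP: one_notin_filt1; apply: gr_sym_eq0 (mem_filt0 F _) _.
by rewrite gr_sym1.
Qed.

Definition grC : comNzRingType := comring gr_mulA gr_mulC gr_oner_neq0.

Definition sym n x : grC := gr_sym F n x.

Definition gr_grading : grading grC :=
  @Grading grC (@gr_pr R F) (@gr_prB R F) (@gr_prM R F) (@gr_pr_pr R F)
    (@gr_pr1 R F) (@gr_pr_finite R F).

Local Notation g := gr_grading.

Lemma symB n x y : x \in F n -> y \in F n -> sym n (x - y) = sym n x - sym n y.
Proof. exact: gr_symB. Qed.
Lemma symD n x y : x \in F n -> y \in F n -> sym n (x + y) = sym n x + sym n y.
Proof. exact: gr_symD. Qed.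
Lemma sym0 n : sym n 0 = 0. Proof. exact: gr_sym0. Qed.
Lemma sym1 : sym 0 1%g = 1. Proof. exact: gr_sym1. Qed.
Lemma symM i j x y : x \in F i -> y \in F j ->
  sym i x * sym j y = sym (i + j)%N (x ** y).
Proof. exact: gr_symM. Qed.
Lemma pr_sym m n x : g m (sym n x) = if m == n then sym n x else 0.
Proof. exact: gr_pr_sym. Qed.
Lemma pr_is_sym n a : exists2 x, x \in F n & g n a = sym n x.
Proof. exact: gr_pr_is_sym. Qed.
Lemma sym_inj n x y : x \in F n -> y \in F n -> sym n x = sym n y -> x - y \in F n.+1.
Proof. exact: gr_sym_inj. Qed.

(** Scalars from R / F^1 lie in degree 0 of gr(R), so closure under multiplication by degree 0
    components covers them. *)
Lemma generated_of_generates (X : set grC) :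
  generates (@gr_scalar R F) X -> generated_over_pr0 g X.
Proof.
move=> hX B B1 BB BM BZ XB x; suff -> : B = setT by [].
apply: hX => //; split=> // c y hy.
have <- : g 0%N (gr_scalar c) = gr_scalar c by apply: dsumP => -[|k].
exact: BZ.
Qed.

Lemma gr_degree1_generators : exists ys, degree1_generators g ys.
Proof.
case: hF => _ _ _ [n [x hx]] h1.
pose xs : seq grC := [seq (x i : grC) | i <- enum 'I_n].
apply: (@exists_degree1_generators grC g xs).
  apply: generated_of_generates; congr (generates _ _): hx.
  apply/seteqP; split=> [_ [i _ <-]|_ /mapP[i _ ->]] /=; last by exists i.
  by apply/mapP; exists i; rewrite ?mem_enum.
apply: generated_of_generates; congr (generates _ _): h1.
apply/seteqP; split=> a /= ha; last first.
  by move=> k /eqP k1; rewrite -ha /= /gr_single (negbTE k1).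
by apply: dsumP => k; rewrite /= /gr_single; case: eqP => // /ha ->.
Qed.

Lemma gr_degree0_inverse c : g 0%N c <> 0 -> exists b, g 0%N b * g 0%N c = 1.
Proof.
have [x hx ->] := pr_is_sym 0 c => x0.
have [|y hy] := @left_inverse_mod_filt1 x.
  apply/negP => x1; apply: x0; rewrite -(sym0 0%N); apply: dsumP => -[|k] //=.
  rewrite /gr_single /=; apply/gr_classP.
  by rewrite !val_clip ?rpred0 ?mem_filt0 // subr0.
exists (sym 0 y); rewrite pr_sym /= symM ?mem_filt0 // -sym1.
apply: dsumP => -[|k] //=; rewrite /gr_single /=; apply/gr_classP.
by rewrite !val_clip ?mem_filt0.
Qed.

Lemma gr_rees_noetherian : noetherian (graded_rees g).
Proof.
have [ys hys] := gr_degree1_generators.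
exact: graded_rees_noetherian hys gr_degree0_inverse.
Qed.

(** A left ideal with an element [x] outside F^1 contains some z = y x congruent to 1 modulo F^1.
    For [t] in F^m, t - t z = t (1 - z) lies in F^(m+1), so approximation yields R = R z. *)
Lemma filt1_local : local_with_maximal_ideal (F 1%N).
Proof.
split=> [h|I hI InT x Ix].
  by case/negP: one_notin_filt1; have : [set` F 1%N] 1%g by rewrite h.
apply: contrapT => /negP /left_inverse_mod_filt1[y hy]; apply: InT.
have [I0 IB IM] := hI.
apply/seteqP; split=> // z _.
have hz : span (combinations [:: y ** x] id [fun _ => [set s | s \in F 0%N]]) z.
  apply: (@lift_span _ _ F_complete _ _ _ (fun=> 0%N) setT 0 0) (mem_filt0 F z) => // m t _ _ ht.
  exists (t ** (y ** x)); split=> //.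
    apply: span_gen; exists (y ** x), t; split=> //; first exact: mem_head.
    by rewrite /= subn0 mem_filt0.
  rewrite -[X in X - _]mulg1 -namulBr -addn1; apply: (mem_filtM erefl ht).
  by rewrite -opprB rpredN.
move: z hz; apply: span_ind_add => // [u v hu hv|_ [i [s [+ _ ->]]]].
  by rewrite -[v]opprK -[- v]add0r; apply: (IB) => //; apply: IB.
(* The bracketing [s ** (y ** x)] stays in [I] by two left multiplications. *)
by rewrite inE => /eqP ->; do 2!apply: (IM).
Qed.

(** Lifts of generators [ws] of gr_j serve as right factors. An element of F^m with m >= i + j is
    matched modulo F^(m+1) using coefficients in F^(m-j), a subset of F^i. *)
Lemma filt_prodset i j : prodset [set` F i] [set` F j] = [set` F (i + j)%N].
Proof.
apply/seteqP; split; first exact: filtM.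
have [ys hys] := gr_degree1_generators.
have [ws [wsj hws]] := degreej_generators j hys.
(* [f w] lifts the degree [j] component of [w]; the default 0 never occurs as such, since every
   component is a symbol. *)
pose f w := xget 0 [set r | r \in F j /\ g j w = sym j r].
have hf w : f w \in F j /\ g j w = sym j (f w).
  by apply: (@xgetPex _ 0 [set r | r \in F j /\ g j w = sym j r]);
     case: (pr_is_sym j w) => r; exists r.
move=> x hx.
have : span (combinations ws f [fun _ => [set s | s \in F i]]) x.
  apply: (@lift_span _ _ F_complete _ _ _ (fun=> i) setT (i + j) j) hx => // m t ijm _ ht.
  have [k ik km] : exists2 k, (i <= k)%N & m = (k + j)%N.
    exists (m - j)%N; first by rewrite -(addnK j i) leq_sub2r.
    by rewrite subnK // (leq_trans _ ijm) // leq_addl.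
  rewrite {}km addnK in ht *.
  suff [y [hy Fy ey]] : exists y, [/\ span (combinations ws f
      [fun _ => [set s | s \in F i /\ s \in F k]]) y, y \in F (k + j)%N &
      sym (k + j) y = sym (k + j) t].
    by exists y; split=> //; apply: sym_inj.
  have -> : sym (k + j) t = g (k + j)%N (sym (k + j) t) by rewrite pr_sym eqxx.
  elim: (hws k (sym (k + j) t)) => [|_ a [c [w [hw ->]]] _ [y [hy Fy ey]]].
    by exists 0; rewrite rpred0 sym0; split=> //; exact: span0.
  have [s hs ->] := pr_is_sym k c; have [Ff ef] := hf w.
  have Fsf : s ** f w \in F (k + j)%N by exact: mem_filtM hs Ff.
  exists (s ** f w + y); split; last by rewrite symD // ey -symM // -ef wsj.
    apply: spanDl => //; exists w, s; split=> //; split=> //.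
    exact: filt_le hs.
  exact: rpredD.
move=> hspan; have [l|l a b ha hb|s hs ->] := span_coefficients _ _ hspan.
- exact: rpred0.
- exact: rpredD.
exists (size (undup ws)), (fun l => s (tnth (in_tuple (undup ws)) l)),
  (fun l => f (tnth (in_tuple (undup ws)) l)); split=> [l|l|].
- exact: hs.
- by case: (hf (tnth (in_tuple (undup ws)) l)).
- by rewrite big_tnth.
Qed.

(** * Graded left ideals of the Rees ring, given by their components [J n] *)

Section GradedFamily.
Variable J : nat -> set R.
Hypotheses (JF : forall n, J n `<=` [set` F n]) (J0 : forall n, J n 0).
Hypothesis JB : forall n x y, J n x -> J n y -> J n (x - y).
Hypothesis JM : forall j n u x, u \in F j -> J n x -> J (j + n)%N (u ** x).

Let JD n x y : J n x -> J n y -> J n (x + y).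
Proof.
by move=> hx hy; rewrite -[y]opprK -[- y]add0r; apply: JB => //; apply: JB => //; exact: J0.
Qed.

Definition symbols n m : set grC := [set a | exists x, [/\ J n x, x \in F m & a = sym m x]].

(** Imposing the condition on each component of degree [m] at [X^n] makes the ideal bihomogeneous,
    so that components of generators can be lifted separately. *)
Definition symbol_ideal : set {poly grC} :=
  [set p | graded_rees g p /\ forall n m, symbols n m (g m p`_n)].

Let symbols0 n m : symbols n m 0.
Proof. by exists 0; rewrite rpred0 sym0. Qed.

Let symbolsD n m a b : symbols n m a -> symbols n m b -> symbols n m (a + b).
Proof.
move=> [x [hx Fx ->]] [y [hy Fy ->]]; exists (x + y).
by rewrite symD // rpredD //; split=> //; exact: JD.
Qed.

Lemma symbol_ideal_ideal : ideal_of (graded_rees g) symbol_ideal.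
Proof.
split.
- by move=> p [].
- split=> [|n m]; last by rewrite coef0 pr0.
  by case: (graded_rees_subring g) => _ + _ => /(_ 1 1); rewrite subrr; apply;
    case: (graded_rees_subring g).
- move=> p q [hp Jp] [hq Jq]; split; first by case: (graded_rees_subring g) => _ + _; apply.
  move=> n m; have [x [hx Fx ex]] := Jp n m; have [y [hy Fy ey]] := Jq n m.
  exists (x - y); rewrite coefB prB ex ey symB // rpredB //; split=> //; exact: JB.
- move=> c p hc [hp Jp]; split; first by case: (graded_rees_subring g) => _ _; apply.
  move=> n m; rewrite coefM (big_morph (g m) (@prD _ g m) (@pr0 _ g m)).
  elim/big_ind: _ => [||i _]; [exact: symbols0 | exact: symbolsD | ].
  rewrite prM; elim/big_ind: _ => [||l _]; [exact: symbols0 | exact: symbolsD | ].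
  (* A component of [c] at [X^i] vanishes in degree [l < i]. For [l >= i] its lift is in [F i],
     hence multiplies [J (n - i)] into [J n]. *)
  have [li|il] := ltnP l i; first by rewrite hc // mul0r.
  have [x [hx Fx ->]] := Jp (n - i)%N (m - l)%N.
  have [u Fu ->] := pr_is_sym l c`_i.
  exists (u ** x); split.
  + by have := JM (filt_le il Fu) hx; rewrite subnKC // leq_ord.
  + by apply: mem_filtM Fu Fx; rewrite subnKC // leq_ord.
  + by rewrite symM // subnKC // leq_ord.
Qed.

(** Only finitely many bihomogeneous components are nonzero; each is lifted to an element of [J],
    stored with its exponent [n] and degree [m]. *)
Lemma symbol_representatives (p : {poly grC}) : symbol_ideal p ->
  exists ts : seq (R * (nat * nat)), (forall t, t \in ts -> J t.2.1 t.1 /\ t.1 \in F t.2.2) /\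
    forall n m, g m p`_n = 0 \/ exists t, [/\ t \in ts, t.2 = (n, m) & g m p`_n = sym m t.1].
Proof.
move=> [_ hp].
have /choice[W hW] : forall nm : nat * nat, exists x,
    [/\ J nm.1 x, x \in F nm.2 & g nm.2 p`_nm.1 = sym nm.2 x].
  by move=> [n m]; exact: hp.
have /choice[M hM] : forall n, exists M, forall m, (M <= m)%N -> g m p`_n = 0.
  by move=> n; exact: pr_bounded.
pose N := \max_(n < size p) M n.
exists [seq (W nm, nm) | nm <- [seq (n, m) | n <- iota 0 (size p), m <- iota 0 N]].
split=> [_ /mapP[nm _ ->]|n m]; first by case: (hW nm).
have [pn|np] := leqP (size p) n; first by left; rewrite nth_default // pr0.
have [Nm|mN] := leqP N m.
  left; apply: hM; apply: leq_trans Nm; exact: (leq_bigmax (Ordinal np)).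
right; exists (W (n, m), (n, m)); split=> //; last by case: (hW (n, m)).
apply: (map_f (fun nm => (W nm, nm))); apply/allpairsP; exists (n, m).
by rewrite !mem_iota.
Qed.

(** The lifted components of generators of the symbol ideal work: expanding the monomial
    [sym m x *: 'X^n] and lifting the expansion gives an element of [J n] equal to [x] modulo
    [F m.+1]. Coefficients in [F (n - w.2)] are those of monomials of the Rees ring. *)
Lemma graded_family_spanned : exists ws : seq (R * nat),
  (forall w, w \in ws -> J w.2 w.1) /\ forall n x, J n x ->
    span [set z | exists w u, [/\ w \in ws, (w.2 <= n)%N, u \in F (n - w.2)%N & z = u ** w.1]] x.
Proof.
have [gs [hgs spangs]] := gr_rees_noetherian symbol_ideal_ideal.
have [ts [hts tsgs]] : exists ts : seq (R * (nat * nat)),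
    (forall t, t \in ts -> J t.2.1 t.1 /\ t.1 \in F t.2.2) /\
    forall p, p \in gs -> forall n m, g m p`_n = 0 \/
      exists t, [/\ t \in ts, t.2 = (n, m) & g m p`_n = sym m t.1].
  elim: gs hgs {spangs} => [|p gs ih] hgs; first by exists [::].
  have [|ts [hts tsgs]] := ih; first by move=> q hq; apply: hgs; rewrite in_cons hq orbT.
  have [us [hus usp]] := symbol_representatives (hgs p (mem_head _ _)).
  exists (us ++ ts); split=> [t|q].
    by rewrite mem_cat => /orP[/hus|/hts].
  rewrite in_cons => /predU1P[->|hq] n m.
    have [->|[t [ht e1 e2]]] := usp n m; [by left | right].
    by exists t; rewrite mem_cat ht.
  have [->|[t [ht e1 e2]]] := tsgs q hq n m; [by left | right].
  by exists t; rewrite mem_cat ht orbT.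
(* This bound on the degrees of the generators is the loss [D] in the approximation. *)
have [D hD] : exists D, forall t, t \in ts -> (t.2.2 <= D)%N.
  exists (\max_(t <- ts) t.2.2) => t ht; exact: (leq_bigmax_seq t).
exists [seq (t.1, t.2.1) | t <- ts]; split=> [_ /mapP[t /hts[ht _] ->] //|n x Jx].
have : span (combinations [seq t <- ts | (t.2.1 <= n)%N] fst
    [fun t => [set s | s \in F (n - t.2.1)%N]]) x.
  apply: (@lift_span _ _ F_complete _ _ _ (fun t => n - t.2.1)%N (J n) 0 D) Jx (mem_filt0 F x).
  move=> m {}x _ Jx Fx.
  pose G n m := combinations [seq t <- ts | (t.2.1 <= n)%N] fst
    [fun t => [set s | s \in F (n - t.2.1)%N /\ s \in F (m - D)%N]].
  pose Q n m (a : grC) := exists y, [/\ span (G n m) y, J n y, y \in F m & sym m y = a].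
  have Q0 k l : Q k l 0 by exists 0; rewrite rpred0 sym0; split=> //; exact: span0.
  have QD k l a b : Q k l a -> Q k l b -> Q k l (a + b).
    move=> [y [hy Jy Fy <-]] [z [hz Jz Fz <-]]; exists (y + z).
    by rewrite symD // rpredD //; split=> //; [exact: spanD | exact: JD].
  suff [y [hy Jy Fy ey]] : Q n m (sym m x).
    by exists y; split=> //; [exact: JB | exact: sym_inj].
  have : symbol_ideal (sym m x *: 'X^n).
    split=> k l.
      rewrite coefZ coefXn => lk; case: eqP lk => [-> ln|_ _]; last by rewrite mulr0 pr0.
      rewrite mulr1 pr_sym; case: eqP => // lm.
      (* If [m < n], then [x] lies in [F n], inside [F m.+1], so its symbol of degree [m] is 0. *)
      have : x \in F n by apply: JF.
      rewrite lm in ln => /(filt_le ln) Fx'.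
      rewrite -(sym0 m); apply: dsumP => i; rewrite /= /gr_single; case: eqP => // ->.
      by apply/gr_classP; rewrite !val_clip ?rpred0 // subr0.
    rewrite coefZ coefXn; case: eqP => [->|_]; last by rewrite mulr0 pr0; exact: symbols0.
    rewrite mulr1 pr_sym; case: eqP => [->|_]; last exact: symbols0.
    by exists x.
  move=> /spangs hspan.
  (* Taking the component of degree [m] at [X^n] reduces the expansion to products of symbols, which
     lift to products [u ** t.1]. *)
  have -> : sym m x = g m (sym m x *: 'X^n)`_n.
    by rewrite coefZ coefXn eqxx mulr1 pr_sym eqxx.
  elim: hspan => [|_ q [c [p [hc hp ->]]] _ ih]; first by rewrite coef0 pr0.
  rewrite coefD prD; apply: (QD) ih.
  rewrite coefM (big_morph (g m) (@prD _ g m) (@pr0 _ g m)).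
  elim/big_ind: _ => [||i _]; [exact: Q0 | exact: QD | ].
  rewrite prM; elim/big_ind: _ => [||l _]; [exact: Q0 | exact: QD | ].
  have [li|il] := ltnP l i; first by rewrite hc // mul0r.
  have [->|[t [ht t2 ->]]] := tsgs p hp (n - i)%N (m - l)%N; first by rewrite mulr0.
  have [u Fu ->] := pr_is_sym l c`_i.
  have [Jt Ft] := hts t ht; have := hD t ht; rewrite t2 /= in Jt Ft * => lD.
  have ei : (n - (n - i))%N = i by rewrite subKn // leq_ord.
  exists (u ** t.1); split.
  + apply: span_gen; exists t, u; rewrite mem_filter t2 /= leq_subr ht; split=> //.
    rewrite /= t2 /= ei; split; first exact: filt_le Fu.
    (* The generator has degree [m - l], at most [D], so [m - D <= l]. *)
    apply: filt_le Fu; by rewrite leq_subLR addnC -leq_subLR.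
  + by have := JM (filt_le il Fu) Jt; rewrite subnKC // leq_ord.
  + by apply: mem_filtM Fu Ft; rewrite subnKC // leq_ord.
  + by rewrite symM // subnKC // leq_ord.
apply: span_sub => _ [t [u [+ hu ->]]]; rewrite mem_filter => /andP[tn ht].
apply: span_gen; exists (t.1, t.2.1), u; split=> //.
exact: (map_f (fun t => (t.1, t.2.1))).
Qed.

End GradedFamily.

End LocalFiltered.

(** * The Rees ring: constant terms and leading coefficients *)

Section Rees.
Variables (R : naRingType) (F : filtration R).
Implicit Types (p q : rees F).

Definition rcoef p n : R := Defs.coord (val p) n.

Lemma rcoefB p q n : rcoef (p - q) n = rcoef p n - rcoef q n.
Proof. by rewrite /rcoef raddfB. Qed.

Lemma rcoef0 n : rcoef 0 n = 0.
Proof. by rewrite /rcoef raddf0. Qed.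

Lemma rcoefD p q n : rcoef (p + q) n = rcoef p n + rcoef q n.
Proof. by rewrite /rcoef raddfD. Qed.

Lemma rcoefM p q n : rcoef (p ** q) n = \sum_(i < n.+1) rcoef p i ** rcoef q (n - i)%N.
Proof. by rewrite /rcoef valM. Qed.

Lemma rcoef_filt p n : rcoef p n \in F n.
Proof. by have /asboolP := valP p; apply. Qed.

Lemma reesP p q : (forall n, rcoef p n = rcoef q n) -> p = q.
Proof. by move=> h; apply: val_inj; apply: dsumP. Qed.

Lemma rcoef_bounded p : exists N, forall n, (N <= n)%N -> rcoef p n = 0.
Proof. exact: (coord_finite (val p)). Qed.

Definition monomial_coef (n : nat) (x : R) (k : nat) : poly_graded R k :=
  if k == n then x else 0.

Lemma monomial_subproof n x : exists N, forall k, (N <= k)%N -> monomial_coef n x k = 0.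
Proof. by exists n.+1 => k nk; rewrite /monomial_coef gtn_eqF. Qed.

Lemma rees_monomial n x : x \in F n ->
  exists p, forall k, rcoef p k = if k == n then x else 0.
Proof.
move=> hx; have hp : DSum (monomial_subproof n x) \in rees_pred F.
  apply/asboolP => k /=; rewrite /monomial_coef; case: eqP => [->|_] //.
  exact: rpred0.
by exists (exist (fun p : na_poly R => p \in rees_pred F) _ hp).
Qed.

Lemma rcoef_monomialM n x p q k : (forall k, rcoef p k = if k == n then x else 0) ->
  rcoef (p ** q) k = if (n <= k)%N then x ** rcoef q (k - n)%N else 0.
Proof.
move=> hp; rewrite rcoefM; case: leqP => [nk|kn].
  have nk' : (n < k.+1)%N by [].
  rewrite (bigD1 (Ordinal nk')) //= hp eqxx big1 ?addr0 // => i.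
  by rewrite hp -val_eqE /= => /negbTE ->; rewrite namul0r.
by rewrite big1 // => i _; rewrite hp ltn_eqF ?namul0r // (leq_trans _ kn) // ltnS ?leq_ord.
Qed.

(* The constant terms of generators of the ideal of polynomials with
   coefficients in [I] generate [I]. *)
Lemma noetherian_of_rees : strongly_left_noetherian (rees F) ->
  strongly_left_noetherian R.
Proof.
move=> hN I hI; have [I0 IB IM] := hI.
have hI' : left_ideal [set p | forall n, I (rcoef p n)].
  split=> [n|p q hp hq n|a p hp n].
  - by rewrite rcoef0.
  - by rewrite rcoefB; exact: IB.
  - by rewrite rcoefM; apply: left_ideal_sum => // i _; exact: IM.
have [n [x [hx eI]]] := hN _ hI'.
exists n, (fun i => rcoef (x i) 0); split=> [i|]; first exact: hx.
apply/seteqP; split=> [y Iy|_ [s ->]]; last first.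
  by apply: left_ideal_sum => // i _; apply: IM; exact: hx.
(* View [y] as a constant polynomial and compare constant terms, which are multiplicative. *)
have [p hp] := rees_monomial (mem_filt0 F y).
have : [set p | forall n, I (rcoef p n)] p by move=> k; rewrite hp; case: eqP.
rewrite eI => -[s es]; exists (fun i => rcoef (s i) 0).
rewrite -[LHS](hp 0%N) es (big_morph (rcoef^~ 0%N) (fun p q => rcoefD p q 0) (rcoef0 0)).
by apply: eq_bigr => i _; rewrite rcoefM big_ord1.
Qed.

Hypothesis hF : complete_local_filtered F.

(* The leading coefficients of the elements of a left ideal form a graded left
   ideal; elements having its generators as leading coefficients generate. *)
Lemma rees_noetherian : strongly_left_noetherian (rees F).
Proof.
move=> I hI; have [I0 IB IM] := hI.
have ID p q : I p -> I q -> I (p + q).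
  by move=> hp hq; rewrite -[q]opprK -[- q]add0r; apply: (IB) => //; apply: IB.
(* The element [p] may have degree below [n], so that 0 belongs to [J n]. *)
pose J n : set R := [set x | exists p,
  [/\ I p, forall k, (n < k)%N -> rcoef p k = 0 & rcoef p n = x]].
have JF n : J n `<=` [set` F n] by move=> _ [p [_ _ <-]]; exact: rcoef_filt.
have J0 n : J n 0 by exists 0; rewrite rcoef0; split=> // k _; rewrite rcoef0.
have JB n x y : J n x -> J n y -> J n (x - y).
  move=> [p [Ip hp <-]] [q [Iq hq <-]]; exists (p - q); rewrite rcoefB.
  by split=> // [|k nk]; [exact: IB | rewrite rcoefB hp // hq // subrr].
have JM j n u x : u \in F j -> J n x -> J (j + n)%N (u ** x).
  move=> hu [p [Ip hp <-]]; have [q hq] := rees_monomial hu.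
  exists (q ** p); rewrite (rcoef_monomialM _ _ hq) leq_addr addKn.
  split=> // [|k jk]; first exact: IM.
  rewrite (rcoef_monomialM _ _ hq); case: leqP => // jk'.
  by rewrite hp ?namulr0 // ltn_subRL.
have [ws [hws spanws]] := graded_family_spanned hF JF J0 JB JM.
(* [P w] is an element of [I] of degree at most [w.2] whose coefficient there is [w.1]. *)
have /choice[P hP] : forall w : R * nat, exists p, J w.2 w.1 ->
    [/\ I p, forall k, (w.2 < k)%N -> rcoef p k = 0 & rcoef p w.2 = w.1].
  move=> w; have [[p hp]|h] := pselect (J w.2 w.1); first by exists p.
  by exists 0 => /h.
pose gs := map P ws; pose L : set (rees F) := span (combinations gs id (fun=> setT)).
have hgs p : p \in gs -> I p by move=> /mapP[w /hws /hP[]] + _ _ ->.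
apply: (finitely_spanned_seq hI hgs) => p Ip.
have [n hn] := rcoef_bounded p.
elim: n p Ip hn => [|n ih] p Ip hn.
  rewrite (_ : p = 0); first exact: span0.
  by apply: reesP => k; rewrite hn // rcoef0.
have : J n (rcoef p n) by exists p.
move=> /spanws hx.
(* Each summand [u ** w.1] of the leading coefficient lifts to the monomial with coefficient [u] and
   exponent [n - w.2], times [P w]. Subtracting the resulting [q] lowers the degree bound of [p]. *)
have [q [Lq Iq hq eq]] : exists q, [/\ L q, I q,
    forall k, (n < k)%N -> rcoef q k = 0 & rcoef q n = rcoef p n].
  elim: hx => [|_ y [w [u [hw wn hu ->]]] _ [q [Lq Iq hq eq]]].
    by exists 0; rewrite rcoef0; split=> //; first exact: span0.
  have [Iw hPw ew] := hP w (hws w hw); have [r hr] := rees_monomial hu.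
  exists (r ** P w + q); split.
  - by apply: spanDl => //; exists (P w), r; rewrite map_f.
  - by apply: ID => //; exact: IM.
  - move=> k nk; rewrite rcoefD hq // addr0 (rcoef_monomialM _ _ hr).
    case: leqP => // nwk; rewrite hPw ?namulr0 // ltn_subRL.
    by rewrite subnK.
  - by rewrite rcoefD eq (rcoef_monomialM _ _ hr) leq_subr subKn // ew.
rewrite -(subrK q p); apply: spanD => //; apply: ih; first exact: IB.
move=> k; rewrite leq_eqVlt rcoefB => /predU1P[<-|nk]; first by rewrite eq subrr.
by rewrite hn // hq // subrr.
Qed.

End Rees.

Theorem theorem4p5 (R : naRingType) (F : filtration R)
    (hF : complete_local_filtered F) :
  [/\ local_with_maximal_ideal (F 1%N),
      strongly_left_noetherian R,
      forall i j : nat,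
        prodset [set` F i] [set` F j] = [set` F (i + j)%N]
    & strongly_left_noetherian (rees F)].
Proof.
have hN := rees_noetherian hF.
split=> //; [exact: filt1_local | exact: noetherian_of_rees hN | exact: filt_prodset].
Qed.
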